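(* Let $n\ge 2$ and let $\widetilde A_1,\widetilde A_2,\dots$ be a sequence of $n\times n$ visitation matrices associated to the moves of Rauzy/Zorich induction on an $n$-interval exchange transformation satisfying i.d.o.c. Let $C\in\mathbb N$ with $C\ge \log_2(n+1)-1$, and let $N$ be such that the finite sequence $\widetilde A_1,\dots,\widetilde A_N$ is $C$-complete. Then there is a unique irreducible permutation $\pi$ of $\{1,\dots,n\}$ that can define an $n$-interval exchange transformation whose first $N$ steps of Rauzy/Zorich induction can be given by $\widetilde A_1,\dots,\widetilde A_N$; that is, every $n$-interval exchange transformation whose first $N$ steps can be given by $\widetilde A_1,\dots,\widetilde A_N$ has permutation $\pi$. Moreover, there is an explicit algorithm which, from the $N$ matrices $\widetilde A_1,\dots,\widetilde A_N$, determines $\pi$.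
   Context: $\mathbb N=\{1,2,3,\dots\}$. A permutation $\pi$ of $\{1,\dots,n\}$ is irreducible if $\pi^{-1}(\{1,\dots,k\})\ne\{1,\dots,k\}$ for all $1\le k\le n-1$. Interval exchanges. An $n$-interval exchange transformation ($n$-IET) is given by an irreducible permutation $\pi$ and a length vector $\lambda=(\lambda_1,\dots,\lambda_n)$ of positive reals. It is the map $T$ of $[0,\lambda_1+\dots+\lambda_n)$ that cuts the interval from left to right into half-open subintervals $I_1,\dots,I_n$ of lengths $\lambda_1,\dots,\lambda_n$ and rearranges them by translations so that $I_i$ becomes the $\pi(i)$-th interval from the left. One step of Rauzy induction on $(\pi,\lambda)$. Let $k=\pi^{-1}(n)$ (so $k\neq n$). The step is defined if $\lambda_n\neq\lambda_k$. It has type $0$ if $\lambda_n>\lambda_k$ and type $1$ if $\lambda_k>\lambda_n$. It produces $(\pi',\lambda')$ with $\lambda=A\lambda'$ (lengths as column vectors), where: Type $0$: $\pi'(i)=\pi(i)$ if $\pi(i)\le\pi(n)$; $\pi'(i)=\pi(i)+1$ if $\pi(n)<\pi(i)<n$; $\pi'(k)=\pi(n)+1$. The visitation matrix $A$ has $A(i,i)=1$ for all $i$, $A(n,k)=1$, and all other entries $0$. Type $1$: $\pi'(i)=\pi(i)$ if $i\le k$; $\pi'(k+1)=\pi(n)$; $\pi'(i)=\pi(i-1)$ if $k+2\le i\le n$. The visitation matrix $A$ has $A(i,i)=1$ for $i\le k$, $A(i,i+1)=1$ for $k\le i\le n-1$, $A(n,k+1)=1$, and all other entries $0$. An $n$-IET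 satisfies i.d.o.c. if and only if Rauzy induction may be applied to it infinitely many times. Rauzy/Zorich induction. Let $A_1,A_2,\dots$ be the matrices of successive Rauzy steps starting from an $n$-IET. Matrices $\widetilde A_1,\widetilde A_2,\dots$ (finitely or infinitely many) are associated to moves of Rauzy/Zorich induction on this IET (the first $N$ steps ''can be given by'' $\widetilde A_1,\dots,\widetilde A_N$) if there are integers $1=m_1<m_2<\cdots$ such that, for each $i$, the Rauzy steps numbered $m_i,\dots,m_{i+1}-1$ all have the same type and $\widetilde A_i=A_{m_i}A_{m_i+1}\cdots A_{m_{i+1}-1}$. Consecutive $\widetilde A_i$ are allowed to have the same type; plain Rauzy induction is the case where each product has one factor. The sequence $A_1,A_2,\dots$ is called an underlying Rauzy path. Completeness. A finite Rauzy path with matrices $A_1,\dots,A_M$ is complete if each row of $A_1A_2\cdots A_M$ has at least two nonzero entries. It is $C$-complete if it is a concatenation of $C$ complete Rauzy paths. A finite sequence $\widetilde A_1,\dots,\widetilde A_N$ of matrices associated to moves of Rauzy/Zorich induction on an $n$-IET (that is, $\widetilde A_i=A_{m_i}A_{m_i+1}\cdots A_{m_{i+1}-1}$ for $1\le i\le N$, where $1=m_1<m_2<\cdots<m_{N+1}$ are integers, $A_1,\dots,A_{m_{N+1}-1}$ are the matrices of successive Rauzy steps starting from an $n$-IET, and for each $i$ the steps numbered $m_i,\dots,m_{i+1}-1$ all have the same type) is $C$-complete if it has an underlying Rauzy path $A_1,\dots,A_{m_{N+1}-1}$ that is $C$-complete. *)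

(* Defs.v *)
From mathcomp Require Import all_boot all_order all_fingroup all_algebra.
From mathcomp Require Import reals exp.

Set Implicit Arguments.
Unset Strict Implicit.
Unset Printing Implicit Defensive.

Import Order.TTheory GRing.Theory Num.Theory.
Local Open Scope ring_scope.

(* Indices are 0-based throughout: 'I_n stands for {1, ..., n}, the last index
   is the one with value n.-1, and steps and moves are counted from 0. *)

Section IntervalExchange.

Variables (R : realType) (n : nat).
Implicit Types (pi : 'S_n) (lam : 'cV[R]_n).

Definition irreducible pi : Prop :=
  forall k : nat, (0 < k)%N -> (k < n)%N ->
    pi @^-1: [set i : 'I_n | (i < k)%N] <> [set i : 'I_n | (i < k)%N].

Definition is_iet (T : 'S_n * 'cV[R]_n) : Prop :=
  irreducible T.1 /\ (forall i, 0 < T.2 i ord0).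

(* Left endpoint of the i-th interval, before and after the exchange. *)
Definition left_end lam (i : 'I_n) : R :=
  \sum_(j < n | (j < i)%N) lam j ord0.

Definition image_left_end pi lam (i : 'I_n) : R :=
  \sum_(j < n | (pi j < pi i)%N) lam j ord0.

(* For x in [0, lam_1 + ... + lam_n) exactly one i contributes to the sum;
   outside this interval the map is (irrelevantly) the identity. *)
Definition iet_map (T : 'S_n * 'cV[R]_n) (x : R) : R :=
  x + \sum_(i < n | left_end T.2 i <= x < left_end T.2 i + T.2 i ord0)
        (image_left_end T.1 T.2 i - left_end T.2 i).

(* Infinite distinct orbit condition: the orbits of the n - 1 division points
   lam_1 + ... + lam_i (1 <= i < n) are infinite and pairwise disjoint.  As the
   map is a bijection, forward orbits suffice. *)
Definition idoc (T : 'S_n * 'cV[R]_n) : Prop :=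
  forall (i j : 'I_n) (p q : nat), (0 < i)%N -> (0 < j)%N ->
    iter p (iet_map T) (left_end T.2 i) = iter q (iet_map T) (left_end T.2 j) ->
    i = j /\ p = q.

End IntervalExchange.

(* In the next two definitions l is the last index and k = pi^-1 (last);
   the type of a step is a boolean (false for 0, true for 1). *)
Definition rauzy_perm n (t : bool) (pi : 'S_n) (l k i : 'I_n) : nat :=
  if t then
    if (i <= k)%N then pi i : nat
    else if i == k.+1 :> nat then pi l : nat
    else pi (ord_pred i)
  else
    if (pi i <= pi l)%N then pi i : nat
    else if ((pi i).+1 < n)%N then (pi i).+1
    else (pi l).+1.

Definition visitation n (t : bool) (l k : 'I_n) : 'M[nat]_n :=
  \matrix_(i, j) nat_of_bool
    (if t then
       [|| (i == j) && (i <= k)%N, (k <= i)%N && (j == i.+1 :> nat)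
         | (i == l) && (j == k.+1 :> nat)]
     else (i == j) || (i == l) && (j == k)).

Section Rauzy.

Variables (R : realType) (n : nat).
Implicit Type T : 'S_n * 'cV[R]_n.

Definition rauzy_step (t : bool) (A : 'M[nat]_n) T T' : Prop :=
  exists l k : 'I_n,
    [/\ l.+1 = n /\ (T.1 k).+1 = n,
        if t then T.2 l ord0 < T.2 k ord0 else T.2 k ord0 < T.2 l ord0,
        forall i, T'.1 i = rauzy_perm t T.1 l k i :> nat,
        A = visitation t l k
      & T.2 = map_mx (fun a : nat => a%:R) A *m T'.2].

(* A length is None for an infinite sequence. *)
Definition in_range (L : option nat) (i : nat) : bool :=
  if L is Some l then (i < l)%N else true.

(* The matrices At 0, At 1, ... (L of them) are associated to moves of
   Rauzy/Zorich induction on T, the i-th one being the product of the matrices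
   A j of the Rauzy steps m i <= j < m i.+1. *)
Definition underlying (L : option nat) T (At : nat -> 'M[nat]_n)
    (A : nat -> 'M[nat]_n) (m : nat -> nat) : Prop :=
  exists (X : nat -> 'S_n * 'cV[R]_n) (t : nat -> bool),
    [/\ X 0%N = T, m 0%N = 0%N &
      forall i, in_range L i ->
        [/\ (m i < m i.+1)%N,
            forall j, (m i <= j < m i.+1)%N ->
              t j = t (m i) /\ rauzy_step (t j) (A j) (X j) (X j.+1)
          & At i = \prod_(m i <= j < m i.+1) A j]].

Definition zorich_moves (L : option nat) T (At : nat -> 'M[nat]_n) : Prop :=
  exists (A : nat -> 'M[nat]_n) (m : nat -> nat), underlying L T At A m.

Definition complete (s : seq 'M[nat]_n) : Prop :=
  forall i : 'I_n, (1 < #|[set j | (\prod_(A <- s) A)%R i j != 0%N]|)%N.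

Definition C_complete_path (C : nat) (s : seq 'M[nat]_n) : Prop :=
  exists P : seq (seq 'M[nat]_n),
    [/\ size P = C, flatten P = s & forall p, p \in P -> complete p].

Definition C_complete (C N : nat) (At : nat -> 'M[nat]_n) : Prop :=
  exists T (A : nat -> 'M[nat]_n) (m : nat -> nat),
    [/\ is_iet T, underlying (Some N) T At A m
    & C_complete_path C [seq A j | j <- iota 0 (m N)]].

Definition can_define (N : nat) (At : nat -> 'M[nat]_n) (pi : 'S_n) : Prop :=
  exists lam : 'cV[R]_n,
    is_iet (pi, lam) /\ zorich_moves (Some N) (pi, lam) At.

End Rauzy.

(* Total recursive functions: the closure of the basic functions under
   composition, primitive recursion and regular (everywhere successful)
   minimization. *)
Inductive recursive : forall k, (k.-tuple nat -> nat) -> Prop :=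
| rec_zero k : @recursive k (fun=> 0%N)
| rec_succ : @recursive 1 (fun v => (thead v).+1)
| rec_proj k (i : 'I_k) : @recursive k (fun v => tnth v i)
| rec_comp k m (g : m.-tuple nat -> nat) (h : 'I_m -> k.-tuple nat -> nat) :
    recursive g -> (forall i, recursive (h i)) ->
    @recursive k (fun v => g [tuple h i v | i < m])
| rec_prec k (g : k.-tuple nat -> nat) (h : k.+2.-tuple nat -> nat) :
    recursive g -> recursive h ->
    @recursive k.+1 (fun v =>
      nat_rect (fun=> nat) (g [tuple of behead v])
        (fun a b => h [tuple of a :: b :: behead v]) (thead v))
| rec_mu k (g : k.+1.-tuple nat -> nat) (f : k.-tuple nat -> nat) :
    recursive g ->
    (forall v, g [tuple of f v :: v] = 0%N) ->
    (forall v a, (a < f v)%N -> g [tuple of a :: v] <> 0%N) ->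
    recursive f.

(* pickle is the Goedel numbering of the library; on iterated sequences of
   natural numbers it is the explicit coding CodeSeq.code. *)
Definition computable (S T : countType) (f : S -> T) : Prop :=
  exists2 g : 1.-tuple nat -> nat,
    recursive g & forall x, g [tuple pickle x] = pickle (f x).

Definition mx_rows n (A : 'M[nat]_n) : seq (seq nat) :=
  [seq [seq A i j | j <- enum 'I_n] | i <- enum 'I_n].

Definition perm_word n (pi : 'S_n) : seq nat :=
  [seq (pi i : nat) | i <- enum 'I_n].

(* Main.v *)
Require Import Defs.
From mathcomp Require Import all_boot all_order all_fingroup all_algebra.
From mathcomp Require Import boolp reals exp.
From mathcomp Require Import zify.

(** Uniqueness.  Let [pi1] be the permutation of a path that realizes the
    matrices and is C-complete, and let [pi2] be another permutation realizing
    the same matrices.  The matrix of a block of steps of one type reveals the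
    position of the winning interval (the only row whose sum exceeds 1), hence
    the type, and the number of steps; in type 0 it also reveals how often each
    interval loses, although not in which order ([block_ok_inj]).  So both
    paths relabel the positions in the same way, and it makes sense to compare
    them letter by letter: call two letters adjacent when [pi1] and [pi2] order
    their images differently ([differ]).

    A type 1 block does not change this graph, and its winner, which both
    permutations send to the last place, is isolated.  In a type 0 block with
    winner [l], either [l] is isolated, and the two runs rotate the same
    letters ([run0_dichotomy]), or the losers are, for both permutations, the
    [p] letters sent to the last [p] places, and each of them loses once.  The
    set of losers is then a union of components not containing [l], and moving
    it next to [l] makes every neighbour of [l] a neighbour of every loser.  In
    all cases edges persist ([run0_differS]), and if [l] is not isolated, its
    component absorbs the losers.

    If [pi1 <> pi2] there is an edge; let [X] be its two ends.  Follow [X] along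
    the first path, adding the loser of each step whose winner is in [X].  By
    the preceding paragraph [X] stays inside one component at the ends of the
    blocks, and every loser that is added is new.  Row [i] of the product of a
    complete path has two nonzero entries only if the letter [i] wins some step
    of it, so each element of [X] wins at least once and [X] at least doubles
    ([piece_growth], [complete_growth]).  After C complete paths [X] has at
    least [2 ^ C.+1] elements.  As [C >= log2 (n + 1) - 1] this exceeds [n], a
    contradiction ([follows_unique]).

    Existence is part of C-completeness: the path that is C-complete starts
    from an interval exchange.

    Algorithm.  The argument for [pi2] uses no lengths, only the row sums and
    the counts of losers along the run that starts from [pi2] and is dictated by
    the types and lengths of the blocks.  This finite test ([follows])
    therefore singles out the permutation among all words, and searching for
    the least code of a word that passes it, up to an explicit bound on the
    codes of permutations, is a recursive function ([rec_searchc]). *)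

Set Implicit Arguments.
Unset Strict Implicit.
Unset Printing Implicit Defensive.

Import Order.TTheory GRing.Theory Num.Theory.
Local Open Scope ring_scope.

(** * One Rauzy step as a relabelling or a rotation *)
Section RauzyPermutations.
Local Open Scope nat_scope.
Local Open Scope group_scope.

Variable n : nat.
Implicit Types (pi : 'S_n.+1) (i j a k : 'I_n.+1) (t : bool).

Local Notation l := (@ord_max n).

(** Inserts the last position just after [a] and shifts the positions in
    between.  Both types of Rauzy step are this cycle: type 0 applies it to the
    images of the intervals, type 1 to the intervals themselves. *)
Definition cycle_fun a i : 'I_n.+1 :=
  if i <= a then i else if i < n then inord i.+1 else inord a.+1.

Lemma cycle_funE a i : cycle_fun a i =
  (if i <= a then i : nat else if i < n then i.+1 else a.+1) :> nat.
Proof.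
rewrite /cycle_fun; case: ifP => // /negbT; rewrite -ltnNge => ai.
by case: ifP => ni; rewrite inordK //; have := ltn_ord i; lia.
Qed.

Lemma cycle_fun_inj a : injective (cycle_fun a).
Proof.
move=> i j /(congr1 (@nat_of_ord _)); rewrite !cycle_funE => e; apply/val_inj.
move: e; have := ltn_ord i; have := ltn_ord j => /=.
by do 2?case: ifP; do 2?case: ifP; lia.
Qed.

Definition cyc a : 'S_n.+1 := perm (@cycle_fun_inj a).

Lemma cycE a i : cyc a i =
  (if i <= a then i : nat else if i < n then i.+1 else a.+1) :> nat.
Proof. by rewrite permE cycle_funE. Qed.

Lemma cyc_id a i : i <= a -> cyc a i = i.
Proof. by move=> ia; apply/val_inj; rewrite /= cycE ia. Qed.

Definition rauzy t pi : 'S_n.+1 :=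
  if t then (cyc (pi^-1 l))^-1 * pi else pi * cyc (pi l).

Definition winner t pi : 'I_n.+1 := if t then pi^-1 l else l.
Definition loser t pi : 'I_n.+1 := if t then l else pi^-1 l.

(** The new position of the interval that was in a given position.  In type 0
    the intervals keep their positions and only the images move. *)
Definition relabel t pi : 'S_n.+1 := if t then cyc (pi^-1 l) else 1.

Lemma rauzy0E pi i : rauzy false pi i = cyc (pi l) (pi i).
Proof. by rewrite permM. Qed.

Lemma rauzy1E pi i : rauzy true pi (cyc (pi^-1 l) i) = pi i.
Proof. by rewrite permM permK. Qed.

Lemma relabel_winner t pi : relabel t pi (winner t pi) = winner t pi.
Proof. by case: t => /=; rewrite ?perm1 ?cyc_id. Qed.

Lemma rauzyE t pi i : rauzy t pi i = rauzy_perm t pi l (pi^-1 l) i :> nat.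
Proof.
case: t; last by rewrite rauzy0E cycE /=; case: ifP.
set k := pi^-1 l; rewrite -[i](permKV (cyc k)) rauzy1E.
set j := _ i; rewrite /= !cycE.
have := ltn_ord j; have [jk|kj] := leqP j k; first by rewrite cyc_id ?jk.
have [jn _|nj jl] := ltnP j n; last first.
  have -> : j = l by apply/val_inj => /=; lia.
  by rewrite leqNgt leqnn /= eqxx.
rewrite ifF; last by lia.
rewrite ifF; last by lia.
congr (pi _ : nat); apply/val_inj; rewrite /= cycE.
have -> : (j <= k) = false by lia.
by rewrite jn /= modnDr modn_small //; lia.
Qed.

(** In letters, the matrix of a step is the identity plus one entry, in the row
    of the winner and the column of the loser; [relabel] accounts for the new
    positions, so that both types have the same shape.  The hypothesis
    [pi l != l] says that winner and loser are distinct. *)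
Lemma visitationE t pi i j : pi l != l ->
  visitation t l (pi^-1 l) i j =
  (j == relabel t pi i) + (i == winner t pi) * (j == relabel t pi (loser t pi)).
Proof.
move=> pil; have kl : pi^-1 l != l.
  by apply: contra_neq pil => e; rewrite -{1}e permKV.
rewrite mxE; case: t => /=; last first.
  rewrite !perm1 [j == i]eq_sym.
  have [->|_] := eqVneq i l; last by rewrite /= orbF addn0.
  have [jl|_] := eqVneq l j; last by rewrite /= mul1n.
  by rewrite -jl [l == _]eq_sym (negPf kl).
set k := pi^-1 l in kl *.
have kn : k < n.
  have := ltn_ord k; rewrite ltnS leq_eqVlt => /orP[/eqP e|//].
  by case/eqP: kl; apply/val_inj.
have cl : cyc k l = k.+1 :> nat by rewrite cycE /= leqNgt kn /= ltnn.
rewrite -!(inj_eq val_inj) /= cl cycE.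
have := ltn_ord i; have := ltn_ord j.
move: (nat_of_ord i) (nat_of_ord j) (nat_of_ord k) kn {kl cl} => x y z kn /=.
have [xz|zx] := leqP x z => yn xn; last first.
  have -> : (x == z) = false by lia.
  rewrite andbF addn0 (ltnW zx) /=; case: (ltnP x n) => xn'.
    have -> : (x == n) = false by lia.
    by rewrite orbF.
  have -> : x = n by lia.
  have -> : (y == n.+1) = false by lia.
  by rewrite eqxx.
have -> : (x == n) = false by lia.
rewrite andbT orbF eq_sym; have [->|ne] := eqVneq x z.
  by rewrite leqnn mul1n; case: (y =P z) => [->|_] //=; rewrite ltn_eqF.
have -> : (z <= x) = false by lia.
by rewrite /= orbF mul0n addn0.
Qed.

End RauzyPermutations.

(** * Runs of type 0 steps *)
Section Runs.
Local Open Scope nat_scope.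
Local Open Scope group_scope.

Variable n : nat.
Implicit Types (pi : 'S_n.+1) (i j a k : 'I_n.+1) (t : bool) (p q : nat).
Implicit Types (X S : {set 'I_n.+1}).

Local Notation l := (@ord_max n).

(** All that a block matrix of type 0 records: the winner being [l] throughout,
    its row counts the losers without their order. *)
Definition losses p pi i : nat := \sum_(q < p) (iter q (rauzy false) pi i == l).

(** Before a full turn, the images beyond that of [l] move [p] places to the
    right, and those that overflow come back just after the image of [l]. *)
Lemma iter_rauzy0 p pi i : p + pi l <= n ->
  iter p (rauzy false) pi i =
  (if pi i <= pi l then pi i : nat
   else if pi i + p <= n then pi i + p else pi i + p - (n - pi l)) :> nat.
Proof.
elim: p i => [|p IH] i pn.
  by rewrite /= addn0; case: leqP => // _; rewrite -ltnS ltn_ord.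
have Hl : iter p (rauzy false) pi l = pi l.
  by apply/val_inj; rewrite /= IH ?leqnn; lia.
rewrite iterS rauzy0E cycE Hl IH; last by lia.
have := ltn_ord (pi i); move: (nat_of_ord (pi i)) (nat_of_ord (pi l)) pn => x a.
by do ![case: ifP]; lia.
Qed.

Lemma iter_rauzy0_fix p pi i : pi i <= pi l -> iter p (rauzy false) pi i = pi i.
Proof.
move=> il; elim: p => [//|p IH]; rewrite iterS rauzy0E cyc_id ?IH //.
suff -> : iter p (rauzy false) pi l = pi l by [].
by elim: p {IH} => [//|p IH]; rewrite iterS rauzy0E cyc_id ?IH.
Qed.

Lemma iter_rauzy0_full pi : iter (n - pi l) (rauzy false) pi = pi.
Proof.
have := ltn_ord (pi l); rewrite ltnS => al.
apply/permP => i; apply/val_inj; rewrite /= iter_rauzy0 ?subnK //.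
by have := ltn_ord (pi i); do 2?[case: ifP]; lia.
Qed.

Lemma lossesD p q pi i :
  losses (p + q) pi i = losses p pi i + losses q (iter p (rauzy false) pi) i.
Proof.
rewrite /losses big_split_ord /=; congr (_ + _)%N; apply: eq_bigr => r _.
by rewrite addnC iterD.
Qed.

Lemma losses_small p pi i : p + pi l <= n -> losses p pi i = (n < pi i + p).
Proof.
elim: p => [|p IH] pn; first by rewrite /losses big_ord0 addn0 ltnNge -ltnS ltn_ord.
rewrite /losses big_ord_recr -/(losses p pi i) IH; last by lia.
rewrite -(inj_eq val_inj) /= iter_rauzy0; last by lia.
have := ltn_ord (pi i); move: (nat_of_ord (pi i)) (nat_of_ord (pi l)) pn => x a.
by case: (leqP x a); case: (leqP (x + p) n); lia.
Qed.

Lemma losses_mono p q pi i : p <= q -> losses p pi i <= losses q pi i.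
Proof. by move=> /subnKC <-; rewrite lossesD leq_addr. Qed.

Lemma losses_gt0 p pi i : pi l != l -> 0 < losses p pi i -> pi l < pi i.
Proof.
move=> pil; apply: contraLR; rewrite -!leqNgt leqn0 => il; apply/eqP.
rewrite /losses big1 // => q _; rewrite iter_rauzy0_fix //.
case: eqP => // e; case/eqP: pil; apply/val_inj => /=; move: il; rewrite e /=.
by have := ltn_ord (pi l); lia.
Qed.

(** The edges of the graph that measures the disagreement of two permutations.
    It compares the orders of images only, not the positions of [i] and [j],
    and so it is transported by the relabelling of a type 1 step. *)
Definition differ pi1 pi2 : rel 'I_n.+1 :=
  fun i j => (pi1 i < pi1 j) != (pi2 i < pi2 j).

Lemma differ_sym pi1 pi2 : symmetric (differ pi1 pi2).
Proof.
move=> i j; have [->//|ij] := eqVneq i j.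
have flip pi : (pi j < pi i) = ~~ (pi i < pi j).
  by rewrite -leqNgt ltn_neqAle (inj_eq val_inj) (inj_eq perm_inj) eq_sym ij.
by rewrite /differ (flip pi1) (flip pi2); do 2!case: (_ < _).
Qed.

Lemma card_below pi v : v <= n.+1 -> #|[set i | pi i < v]| = v.
Proof.
move=> vn; rewrite -[RHS](card_ord v).
have -> : [set i | pi i < v] = pi @^-1: [set widen_ord vn x | x : 'I_v].
  apply/setP => i; rewrite !inE; apply/idP/imsetP => [h|[x _ ->]]; last by rewrite /= ltn_ord.
  by exists (Ordinal h) => //; apply/val_inj.
rewrite card_preimset; last exact: perm_inj.
by rewrite card_imset // => x y /(congr1 val) /= e; apply/val_inj.
Qed.

(** The image of [i] is the number of letters whose image lies before it. *)
Lemma agree_value pi1 pi2 i : (forall j, ~~ differ pi1 pi2 j i) -> pi1 i = pi2 i.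
Proof.
move=> H; apply/val_inj; rewrite /= -(@card_below pi1 (pi1 i)) ?(ltnW (ltn_ord _)) //.
rewrite -[RHS](@card_below pi2 (pi2 i)) ?(ltnW (ltn_ord _)) //.
by apply: eq_card => j; rewrite !inE; have /negPn/eqP := H j.
Qed.

(** The losers of a run of [p] steps that does not complete a turn. *)
Definition top_letters p pi : {set 'I_n.+1} := [set i | n < pi i + p].

(** A short run moves the losers as one block, without changing their order;
    likewise the other letters keep their relative order. *)
Lemma short_order p pi i j : p + pi l <= n -> (i \in top_letters p pi) = (j \in top_letters p pi) ->
  (iter p (rauzy false) pi i < iter p (rauzy false) pi j) = (pi i < pi j).
Proof.
move=> pn; rewrite !inE !iter_rauzy0 //.
have := ltn_ord (pi i); have := ltn_ord (pi j).
move: (nat_of_ord (pi i)) (nat_of_ord (pi j)) (nat_of_ord (pi l)) pn => x y a.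
by case: (leqP x a); case: (leqP y a); case: (leqP (x + p) n); case: (leqP (y + p) n); lia.
Qed.

Lemma short_top p pi i j : p + pi l <= n -> i \in top_letters p pi -> j \notin top_letters p pi ->
  (iter p (rauzy false) pi i < iter p (rauzy false) pi j) = (pi l < pi j).
Proof.
move=> pn; rewrite !inE !iter_rauzy0 //.
have := ltn_ord (pi i); have := ltn_ord (pi j).
move: (nat_of_ord (pi i)) (nat_of_ord (pi j)) (nat_of_ord (pi l)) pn => x y a.
by case: (leqP x a); case: (leqP y a); case: (leqP (x + p) n); case: (leqP (y + p) n); lia.
Qed.

Lemma top_gt p pi i j : i \in top_letters p pi -> j \notin top_letters p pi -> (pi i < pi j) = false.
Proof. by rewrite !inE; lia. Qed.

Section ShortRun.
Variables (p : nat) (pi1 pi2 : 'S_n.+1).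
Hypotheses (sh1 : p + pi1 l <= n) (sh2 : p + pi2 l <= n).
Hypothesis eqtop : top_letters p pi1 = top_letters p pi2.

Let run pi := iter p (rauzy false) pi.

(** Both permutations send the losers after all other letters, so the two
    sorts of letters are never adjacent. *)
Lemma short_closed i j : differ pi1 pi2 i j -> (i \in top_letters p pi1) = (j \in top_letters p pi1).
Proof.
wlog it : i j / i \in top_letters p pi1 => [H d|].
  case it: (i \in _); first by rewrite -(H i j).
  case jt: (j \in _) => //; rewrite -it -(H j i) //; exact: etrans (differ_sym _ _ _ _) d.
rewrite it; case jt: (j \in _) => //; rewrite /differ (top_gt it) ?jt //.
by rewrite (@top_gt p pi2) -?eqtop ?jt.
Qed.

Lemma short_differS i j : differ pi1 pi2 i j -> differ (run pi1) (run pi2) i j.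
Proof.
move=> d; have e := short_closed d.
by rewrite /differ !short_order // -?eqtop.
Qed.

(** The losers end up just after [l], so they compare to [j] as [l] does. *)
Lemma short_differ_new i j : i \in top_letters p pi1 -> differ pi1 pi2 l j ->
  differ (run pi1) (run pi2) i j.
Proof.
move=> it d; have jt : j \notin top_letters p pi1.
  by rewrite -(short_closed d) inE -leqNgt addnC.
by rewrite /differ !short_top // -?eqtop.
Qed.

End ShortRun.

(** The first loser loses again as soon as a turn has been completed. *)
Lemma losses_gt1 p pi : pi l != l -> n < p + pi l -> 1 < losses p pi (pi^-1 l).
Proof.
move=> pil pn; have ln : pi l < n.
  by have := ltn_ord (pi l); rewrite ltnS leq_eqVlt => /orP[/eqP e|//]; case/eqP: pil; apply/val_inj.
(* Step 0 and step [n - pi l], the first one of the second turn. *)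
apply: leq_trans (losses_mono _ _ (_ : n - pi l + 1 <= p)); last by lia.
rewrite lossesD losses_small ?subnK ?(ltnW ln) // permKV /=.
rewrite /losses big_ord1 /= iter_rauzy0_full permKV eqxx; lia.
Qed.

Lemma losses_le1 p pi i : p + pi l <= n -> losses p pi i <= 1.
Proof. by move=> pn; rewrite losses_small //; case: (_ < _). Qed.

Lemma losses_full p pi i : n <= p + pi l -> pi l < pi i -> 0 < losses p pi i.
Proof.
move=> pn il; apply: leq_trans (losses_mono _ _ (_ : n - pi l <= p)); last by lia.
have := ltn_ord (pi l); rewrite ltnS => al; rewrite losses_small ?subnK //.
by rewrite lt0b; lia.
Qed.

(** A count of 2 betrays a completed turn.  Hence two runs with the same
    counts either both stay within one turn, or both complete it; in the latter
    case the letters that have lost are exactly those with an image beyond that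
    of [l], which is why these are the same for both permutations. *)
Lemma run0_dichotomy p pi1 pi2 : pi1 l != l -> pi2 l != l ->
  (forall i, losses p pi1 i = losses p pi2 i) ->
  p + pi1 l <= n /\ p + pi2 l <= n \/
  [/\ forall j, ~~ differ pi1 pi2 l j, n <= p + pi1 l & n <= p + pi2 l].
Proof.
move=> pl1 pl2 eql.
have [s1|f1] := leqP (p + pi1 l) n; have [s2|f2] := leqP (p + pi2 l) n; first by left.
- by have := losses_gt1 pl2 f2; rewrite -eql ltnNge losses_le1.
- by have := losses_gt1 pl1 f1; rewrite eql ltnNge losses_le1.
right; split; [|exact: ltnW..] => j; rewrite /differ negbK; apply/eqP; apply/idP/idP => h.
  by apply: (losses_gt0 pl2 (p := p)); rewrite -eql losses_full // ltnW.
by apply: (losses_gt0 pl1 (p := p)); rewrite eql losses_full // ltnW.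
Qed.

(** After a full turn a permutation is back to where it started.  When [l] is
    isolated both permutations have turns of the same length, so that whole
    turns can be removed, which leaves a short run. *)
Lemma run0_differS p pi1 pi2 i j : pi1 l != l -> pi2 l != l ->
  (forall x, losses p pi1 x = losses p pi2 x) -> differ pi1 pi2 i j ->
  differ (iter p (rauzy false) pi1) (iter p (rauzy false) pi2) i j.
Proof.
move=> pl1 pl2; elim/ltn_ind: p => p IH eql d.
case: (run0_dichotomy pl1 pl2 eql) => [[s1 s2]|[iso f1 f2]].
  apply: short_differS => //; apply/setP => x; have := eql x.
  by rewrite !losses_small // !inE; do 2!case: (_ < _).
have e : pi1 l = pi2 l by apply: agree_value => x; rewrite differ_sym.
(* Hence a turn is not empty, and the induction proceeds. *)
have pl : pi1 l < n.
  have := ltn_ord (pi1 l); rewrite ltnS leq_eqVlt => /orP[/eqP e1|//].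
  by case/eqP: pl1; apply/val_inj.
(* One turn has [n - pi1 l] steps, the number of images beyond that of [l]. *)
have [q pE] : exists q, p = q + (n - pi1 l) by exists (p - (n - pi1 l)); lia.
have full2 : iter (n - pi1 l) (rauzy false) pi2 = pi2 by rewrite e iter_rauzy0_full.
rewrite pE !iterD full2 iter_rauzy0_full.
apply: IH d => [|x]; first by lia.
have := eql x; rewrite pE addnC !lossesD iter_rauzy0_full full2.
have s1 : n - pi1 l + pi1 l <= n by rewrite subnK // ltnW.
have s2 : n - pi1 l + pi2 l <= n by rewrite -e.
rewrite (losses_small _ s1) (losses_small _ s2).
have := iso x; rewrite /differ negbK => /eqP.
have := ltn_ord (pi1 x); have := ltn_ord (pi2 x); rewrite -e.
by move=> h1 h2; do 2!case: ltnP; lia.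
Qed.

End Runs.

(** * Clusters of letters on which two permutations disagree *)
Section Growth.
Local Open Scope nat_scope.
Local Open Scope group_scope.

Variable n : nat.
Implicit Types (pi : 'S_n.+1) (i j a k : 'I_n.+1) (t : bool) (p q : nat).
Implicit Types (X S : {set 'I_n.+1}).

Local Notation l := (@ord_max n).

(** All of [X] lies in one connected component of [differ pi1 pi2]: a union of
    components that meets [X] contains it. *)
Definition clustered pi1 pi2 X := forall S,
  (forall i j, differ pi1 pi2 i j -> i \in S -> j \in S) ->
  forall x y, x \in X -> y \in X -> x \in S -> y \in S.

(** The loser is added before relabelling, as [X] is a set of positions. *)
Definition grow t pi X : {set 'I_n.+1} :=
  relabel t pi @: (if winner t pi \in X then loser t pi |: X else X).

Fixpoint grown t pi X p : {set 'I_n.+1} :=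
  if p is q.+1 then grow t (iter q (rauzy t) pi) (grown t pi X q) else X.

Lemma subset_grow t pi X : relabel t pi @: X \subset grow t pi X.
Proof. by rewrite /grow; case: ifP => _; rewrite imsetS // subsetUr. Qed.

Lemma card_grow t pi X : (winner t pi \in X -> loser t pi \notin X) ->
  #|grow t pi X| = #|X| + (winner t pi \in X).
Proof.
move=> H; rewrite card_imset; last exact: perm_inj.
by case: ifP H => [_ /(_ isT) h|_ _]; rewrite ?cardsU1 ?h addnC.
Qed.

Lemma clustered_differ pi1 pi2 i j : differ pi1 pi2 i j -> clustered pi1 pi2 [set i; j].
Proof.
move=> d S HS x y; rewrite !inE => /orP[]/eqP-> /orP[]/eqP-> //; first exact: HS.
by apply: HS; rewrite differ_sym.
Qed.

(** Otherwise the component of [x] would be [x] alone. *)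
Lemma clustered_neighbour pi1 pi2 X x : clustered pi1 pi2 X -> 1 < #|X| -> x \in X ->
  exists j, differ pi1 pi2 x j.
Proof.
move=> cX X1 xX; apply/existsP; apply: contraLR X1 => /existsPn H.
suff /subset_leq_card : X \subset [set x] by rewrite cards1 -leqNgt.
apply/subsetP => y yX; apply: (cX [set x] _ x) => //; last by rewrite inE.
by move=> i j; rewrite inE => d /eqP ix; have := H j; rewrite -ix d.
Qed.

Lemma rauzy1_last pi : (rauzy true pi)^-1 l = pi^-1 l.
Proof.
apply: (@perm_inj _ (rauzy true pi)); rewrite permKV.
by rewrite -[in RHS](@cyc_id _ (pi^-1 l) (pi^-1 l)) // rauzy1E permKV.
Qed.

(** Both permutations send the winner of a type 1 step to the last place, so
    it has no neighbour.  Apart from that the step only renames positions. *)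
Lemma grow1 pi1 pi2 X : pi1^-1 l = pi2^-1 l -> clustered pi1 pi2 X -> 1 < #|X| ->
  [/\ winner true pi1 \notin X, clustered (rauzy true pi1) (rauzy true pi2) (grow true pi1 X)
    & 1 < #|grow true pi1 X|].
Proof.
move=> e cX X1; have wX : winner true pi1 \notin X.
  apply/negP => /(clustered_neighbour cX X1)[j] /=.
  rewrite /differ {2}e !permKV /= => /eqP[].
  have out pi : (n < pi j) = false by rewrite ltnNge -ltnS ltn_ord.
  by rewrite (out pi1) (out pi2).
split=> //; last by rewrite card_grow (negPf wX) // addn0.
rewrite /grow (negPf wX) => S HS x y /imsetP[x0 x0X ->] /imsetP[y0 y0X ->] xS.
have := cX (cyc (pi1^-1 l) @^-1: S); rewrite /relabel => /(_ _ x0 y0).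
rewrite !inE; apply=> // i j d; rewrite !inE; apply: HS; move: d.
by rewrite /differ !rauzy1E e !rauzy1E.
Qed.

Lemma grown1 p pi1 pi2 X : pi1^-1 l = pi2^-1 l -> clustered pi1 pi2 X -> 1 < #|X| ->
  [/\ forall q, winner true (iter q (rauzy true) pi1) \notin grown true pi1 X q,
      clustered (iter p (rauzy true) pi1) (iter p (rauzy true) pi2) (grown true pi1 X p)
    & 1 < #|grown true pi1 X p|].
Proof.
move=> e cX X1.
(* The winner keeps its position, so both paths keep having the same one. *)
have H q : [/\ (iter q (rauzy true) pi1)^-1 l = (iter q (rauzy true) pi2)^-1 l,
      clustered (iter q (rauzy true) pi1) (iter q (rauzy true) pi2) (grown true pi1 X q)
    & 1 < #|grown true pi1 X q|].
  elim: q => [//|q [e1 c1 X1']]; have [_ ? ?] := grow1 e1 c1 X1'.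
  by split=> //; rewrite !iterS !rauzy1_last.
have [_ cp Xp] := H p; split=> // q; have [e1 c1 Xq] := H q.
by have [h _ _] := grow1 e1 c1 Xq.
Qed.

Lemma top0 pi : top_letters 0 pi = set0.
Proof. by apply/setP => i; rewrite !inE addn0 ltnNge -ltnS ltn_ord. Qed.

Lemma topS p pi : pi l != l -> p + pi l < n ->
  top_letters p.+1 pi = (iter p (rauzy false) pi)^-1 l |: top_letters p pi.
Proof.
move=> pil pn; apply/setP => i; rewrite !inE -(inj_eq (@perm_inj _ (iter p (rauzy false) pi))).
rewrite permKV -(inj_eq val_inj) /= iter_rauzy0; last by lia.
have := ltn_ord (pi i); move: (nat_of_ord (pi i)) (nat_of_ord (pi l)) pn => x a.
by case: (leqP x a); case: (leqP (x + p) n); lia.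
Qed.

Lemma imset_relabel0 pi X : relabel false pi @: X = X.
Proof. by rewrite -[RHS]imset_id; apply: eq_imset => i; rewrite perm1. Qed.

Lemma grown0_out p pi X : l \notin X -> grown false pi X p = X.
Proof.
move=> lX; elim: p => [//|p /= ->].
by rewrite /grow /winner (negPf lX) imset_relabel0.
Qed.

Lemma grown0_in p pi X : pi l != l -> l \in X -> p + pi l <= n ->
  grown false pi X p = X :|: top_letters p pi.
Proof.
move=> pil lX; elim: p => [|p IH] pn; first by rewrite top0 setU0.
rewrite /= IH; last by lia.
by rewrite topS // /grow imset_relabel0 in_setU lX setUCA.
Qed.

(** The heart of the growth argument.  If [l] is in [X] it has a neighbour [k],
    which excludes a completed turn; the losers, being closed under adjacency
    and not containing [l], avoid [X], and after the run all of them are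
    adjacent to [k].  If [l] is not in [X] nothing is added, and [X] stays
    clustered because edges persist. *)
Lemma grown0 p pi1 pi2 X : pi1 l != l -> pi2 l != l ->
  (forall i, losses p pi1 i = losses p pi2 i) ->
  clustered pi1 pi2 X -> 1 < #|X| ->
  (forall q, q < p -> l \in grown false pi1 X q ->
     (iter q (rauzy false) pi1)^-1 l \notin grown false pi1 X q) /\
  clustered (iter p (rauzy false) pi1) (iter p (rauzy false) pi2) (grown false pi1 X p).
Proof.
move=> pl1 pl2 eql cX X1.
have mono S : (forall i j, differ (iter p (rauzy false) pi1) (iter p (rauzy false) pi2) i j ->
     i \in S -> j \in S) -> forall x y, x \in X -> y \in X -> x \in S -> y \in S.
  by move=> HS; apply: cX => i j /(run0_differS pl1 pl2 eql); apply: HS.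
have [lX|lX] := boolP (l \in X); last first.
  split=> [q _|S HS]; first by rewrite grown0_out // (negPf lX).
  by rewrite grown0_out //; apply: mono.
have [k dk] := clustered_neighbour cX X1 lX.
case: (run0_dichotomy pl1 pl2 eql) => [[s1 s2]|[iso _ _]]; last by have := iso k; rewrite dk.
have et : top_letters p pi1 = top_letters p pi2.
  by apply/setP => x; have := eql x; rewrite !losses_small // !inE; do 2!case: (_ < _).
have disj x : x \in X -> x \notin top_letters p pi1.
  move=> xX; rewrite -in_setC; apply: (cX _ _ l) => //.
    by move=> i j d; rewrite !in_setC (short_closed et d).
  by rewrite !inE -leqNgt addnC.
split=> [q qp _|].
  rewrite grown0_in //; last by lia.
  have ktop : (iter q (rauzy false) pi1)^-1 l \in top_letters q.+1 pi1.
    by rewrite topS ?inE ?eqxx //; lia.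
  rewrite in_setU negb_or; apply/andP; split.
    apply: contraTN ktop => /disj; rewrite !inE; lia.
  rewrite inE -leqNgt.
  have := congr1 val (permKV (iter q (rauzy false) pi1) l).
  rewrite /= iter_rauzy0; last by lia.
  have := ltn_ord (pi1 ((iter q (rauzy false) pi1)^-1 l)).
  move: (nat_of_ord (pi1 _)) (nat_of_ord (pi1 l)) s1 => x a s1.
  by case: (leqP x a); case: (leqP (x + q) n); lia.
rewrite grown0_in // => S HS.
(* The neighbour [k] of [l] links [l] to every loser. *)
have kS : k \in S -> l \in S.
  by apply: HS; rewrite differ_sym; apply: short_differS.
have toL x : x \in X :|: top_letters p pi1 -> x \in S -> l \in S.
  rewrite in_setU => /orP[xX|xt xS]; first exact: mono.
  by apply/kS/(HS x k)/xS; apply: short_differ_new.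
have ofL x : x \in X :|: top_letters p pi1 -> l \in S -> x \in S.
  rewrite in_setU => /orP[xX|xt lS]; first exact: mono.
  apply: (HS k x); first by rewrite differ_sym; apply: short_differ_new.
  by apply: HS lS; apply: short_differS.
by move=> x y xX yX /toL - /(_ xX); apply: ofL.
Qed.

End Growth.

(** * Products of visitation matrices *)
Section Matrices.
Local Open Scope nat_scope.

Variable n : nat.
Implicit Types (pi : 'S_n.+1) (i j a k : 'I_n.+1) (t : bool) (p q : nat).
Implicit Types (X : {set 'I_n.+1}) (B M : 'M[nat]_n.+1).

Local Notation l := (@ord_max n).

Definition rowsum M i : nat := \sum_j M i j.

Definition step_mx t pi : 'M[nat]_n.+1 := visitation t l ((pi^-1)%g l).

Definition run_mx t pi q : 'M[nat]_n.+1 := (\prod_(r < q) step_mx t (iter r (rauzy t) pi))%R.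

Lemma winner_rauzy t pi : winner t (rauzy t pi) = winner t pi.
Proof. by case: t => //; apply: rauzy1_last. Qed.

(** The last interval never becomes its own competitor, so a run of one type
    is never blocked for a combinatorial reason. *)
Lemma rauzy_movable t pi : pi l != l -> rauzy t pi l != l.
Proof.
case: t => pil; last by rewrite rauzy0E cyc_id.
apply: contra_neq pil => e; have := rauzy1_last pi.
by rewrite -[in LHS]e permK => kl; rewrite [in LHS]kl permKV.
Qed.

Lemma iter_rauzy_movable t pi q : pi l != l -> iter q (rauzy t) pi l != l.
Proof. by move=> pil; elim: q => //= q; apply: rauzy_movable. Qed.

Lemma iter_winner t pi q : winner t (iter q (rauzy t) pi) = winner t pi.
Proof. by elim: q => // q IH; rewrite iterS winner_rauzy. Qed.

Lemma loser_neq_winner t pi : pi l != l -> loser t pi != winner t pi.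
Proof.
move=> pil; have kl : (pi^-1)%g l != l by apply: contra_neq pil => e; rewrite -{1}e permKV.
by case: t => //=; rewrite eq_sym.
Qed.

Lemma step_mxE t pi i j : pi l != l ->
  step_mx t pi i j = (j == relabel t pi i) + (i == winner t pi) * (j == relabel t pi (loser t pi)).
Proof. exact: visitationE. Qed.

Lemma mul_step B t pi i j : pi l != l ->
  (B * step_mx t pi)%R i j =
    B i ((relabel t pi)^-1%g j) + B i (winner t pi) * (j == relabel t pi (loser t pi)).
Proof.
move=> pil; rewrite -mulmxE mxE.
transitivity (\sum_h (B i h * (j == relabel t pi h)
    + B i h * ((h == winner t pi) * (j == relabel t pi (loser t pi))))).
  by apply: eq_bigr => h _; rewrite step_mxE //; apply: mulnDr.
rewrite big_split /=; congr (_ + _).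
  rewrite (bigD1 ((relabel t pi)^-1%g j)) //= permKV eqxx muln1 big1 ?addn0 // => h.
  by case: (j =P _) => [->|_ _]; rewrite ?permK ?eqxx ?muln0.
rewrite (bigD1 (winner t pi)) //= eqxx mul1n big1 ?addn0 // => h /negPf->.
by rewrite mul0n muln0.
Qed.

Lemma run_mxS t pi q : run_mx t pi q.+1 = (run_mx t pi q * step_mx t (iter q (rauzy t) pi))%R.
Proof. by rewrite /run_mx big_ord_recr. Qed.

(** Within a block the column of the winner is that of the identity, since the
    winner never loses. *)
Lemma run_mx_winner t pi q i : pi l != l -> run_mx t pi q i (winner t pi) = (i == winner t pi).
Proof.
move=> pil; elim: q => [|q IH]; first by rewrite /run_mx big_ord0 mxE; case: (_ == _).
have pq := iter_rauzy_movable t q pil.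
rewrite run_mxS mul_step // iter_winner; set r := relabel _ _.
have rw : r (winner t pi) = winner t pi by rewrite -(iter_winner _ _ q) relabel_winner.
have -> : (r^-1)%g (winner t pi) = winner t pi by rewrite -{1}rw permK.
have -> : (winner t pi == r (loser t (iter q (rauzy t) pi))) = false.
  apply/negbTE; rewrite -{1}rw (inj_eq perm_inj) eq_sym -(iter_winner t pi q).
  exact: loser_neq_winner.
by rewrite muln0 addn0.
Qed.

(** Multiplying by a step adds the column of the winner, a unit vector, to the
    column of the loser, so every step adds one to the row of the winner. *)
Lemma rowsum_run t pi q i : pi l != l -> rowsum (run_mx t pi q) i = 1 + q * (i == winner t pi).
Proof.
move=> pil; elim: q => [|q IH].
  rewrite /rowsum /run_mx big_ord0 (bigD1 i) //= mxE eqxx big1 // => j ji.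
  by rewrite mxE eq_sym (negPf ji).
have pq := iter_rauzy_movable t q pil.
rewrite mulSn addnCA -IH addnC /rowsum run_mxS.
under eq_bigr do rewrite mul_step //.
rewrite big_split /=; congr (_ + _).
  by rewrite [RHS](reindex_inj (@perm_inj _ (relabel t (iter q (rauzy t) pi))^-1%g)).
rewrite -big_distrr /= iter_winner run_mx_winner // //.
rewrite (bigD1 (relabel t (iter q (rauzy t) pi) (loser t (iter q (rauzy t) pi)))) //= eqxx.
by rewrite big1 ?muln1 // => j /negPf->.
Qed.

Lemma run0_mx_last pi q j : pi l != l -> run_mx false pi q l j = (j == l) + losses q pi j.
Proof.
move=> pil; elim: q => [|q IH]; first by rewrite /losses /run_mx !big_ord0 mxE addn0 eq_sym; case: (_ == _).
have pq := iter_rauzy_movable false q pil.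
rewrite run_mxS mul_step // [relabel _ _]/= invg1 !perm1 IH /losses big_ord_recr /= addnA; congr (_ + _).
have := run_mx_winner false q l pil; rewrite /= => ->; rewrite eqxx mul1n.
by rewrite -{2}(permKV (iter q (rauzy false) pi) l) (inj_eq perm_inj).
Qed.

(** A path is complete when all rows of its product are wide. *)
Definition wide M i := 1 < #|[set j | M i j != 0]|.

(** A letter that does not win the first step has a unit row there, so its row
    in the product is a row of the remaining product. *)
Lemma wide_mul t pi B i : pi l != l -> i != winner t pi ->
  wide (step_mx t pi * B)%R i = wide B (relabel t pi i).
Proof.
move=> pil iw; rewrite /wide; congr (1 < _); apply: eq_card => j; rewrite !inE.
congr (_ != _); rewrite -mulmxE mxE (bigD1 (relabel t pi i)) //=.
have -> : step_mx t pi i (relabel t pi i) = 1 by rewrite step_mxE // eqxx (negPf iw).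
rewrite mul1r big1 ?addr0 // => h hi.
by rewrite step_mxE // (negPf hi) (negPf iw); apply: mul0r.
Qed.

Section Path.
Variables (K : nat) (ty : nat -> bool) (P : nat -> 'S_n.+1) (A : nat -> 'M[nat]_n.+1).
Variable X : nat -> {set 'I_n.+1}.
Hypothesis P_movable : forall r, r < K -> P r l != l.
Hypothesis A_step : forall r, r < K -> A r = step_mx (ty r) (P r).
Hypothesis X_grow : forall r, r < K -> X r.+1 = grow (ty r) (P r) (X r).
Hypothesis X_loser : forall r, r < K ->
  winner (ty r) (P r) \in X r -> loser (ty r) (P r) \notin X r.

(** A row that is wide in the product belongs to a letter that wins, and if the
    letter is in [X], the first step that it wins adds an element to [X]. *)
Lemma piece_growth q r : r + q <= K ->
  #|X r| + #|[set i in X r | wide (\prod_(M <- [seq A s | s <- iota r q]) M)%R i]|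
    <= #|X (r + q)|.
Proof.
elim: q r => [|q IH] r rq.
  rewrite /= big_nil addn0 -[leqRHS]addn0 leq_add2l leqn0 cards_eq0; apply/eqP/setP => i.
  rewrite !inE /wide; apply/negbTE; rewrite negb_and -leqNgt; apply/orP; right.
  rewrite -(cards1 i); apply/subset_leq_card/subsetP => j; rewrite !inE mxE.
  by have [] := eqVneq i j.
have rK : r < K by lia.
rewrite addnS -addSn /= big_cons; apply: leq_trans (IH _ _); last by lia.
rewrite X_grow // card_grow; last exact: X_loser.
rewrite -addnA leq_add2l A_step //; set B := \big[_/_]_(_ <- _) _.
set r' := relabel (ty r) (P r); set w := winner _ _.
set Y := [set i in grow _ _ _ | _].
(* Apart from the winner, wide rows come from wide rows of the remaining product. *)
have sub : [set i in X r | wide (step_mx (ty r) (P r) * B)%R i]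
    \subset ([set w] :&: X r) :|: (r' @^-1: Y).
  apply/subsetP => i; rewrite !inE => /andP[iX].
  have [_|iw] := eqVneq i w; first by rewrite iX.
  rewrite wide_mul ?P_movable // => wi; rewrite wi andbT /=.
  by apply: (subsetP (subset_grow _ _ _)); apply: imset_f.
apply: leq_trans (subset_leq_card sub) _.
apply: leq_trans (leq_card_setU _ _) _; rewrite card_preimset ?leq_add2r; last exact: perm_inj.
case wX: (w \in X r).
  by rewrite -[nat_of_bool true](cards1 w); apply/subset_leq_card/subsetIl.
rewrite leqn0 cards_eq0; apply/eqP/setP => i; rewrite !inE.
by case: eqP => // ->; rewrite wX.
Qed.

Lemma complete_growth (s : seq (seq 'M[nat]_n.+1)) r :
  (forall u, u \in s -> complete u) -> r + size (flatten s) <= K ->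
  flatten s = [seq A h | h <- iota r (size (flatten s))] ->
  2 ^ size s * #|X r| <= #|X (r + size (flatten s))|.
Proof.
elim: s r => [|p s IH] r cs; first by rewrite /= addn0 mul1n.
rewrite /= size_cat addnA iotaD map_cat => rK e.
have sz : size p = size [seq A h | h <- iota r (size p)] by rewrite size_map size_iota.
move/eqP: e; rewrite eqseq_cat // => /andP[/eqP ep /eqP es].
apply: leq_trans (IH _ _ _ _) => //; last by move=> q qs; apply: cs; rewrite inE qs orbT.
rewrite expnSr -mulnA leq_mul2l; apply/orP; right.
apply: leq_trans (piece_growth _); last by lia.
rewrite mul2n -addnn leq_add2l; apply/subset_leq_card/subsetP => i iX.
by rewrite inE iX -ep; apply: cs; rewrite inE eqxx.
Qed.
End Path.

End Matrices.

(** * Following a sequence of block matrices *)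
Section Following.
Local Open Scope nat_scope.

Variable n : nat.
Implicit Types (pi : 'S_n.+1) (i j a k : 'I_n.+1) (t : bool) (p q r s : nat).
Implicit Types (X : {set 'I_n.+1}) (B M : 'M[nat]_n.+1).

Local Notation l := (@ord_max n).

(** The row sum of [l] is 1 unless [l] wins, that is, unless the type is 0. *)
Definition mx_type M := rowsum M l == 1.

Definition mx_length M : nat := \sum_i (rowsum M i - 1).

(** What a block matrix tells about the permutation at the start of the block.
    In type 1 it is the position of the winner, in type 0 the number of losses
    of each interval. *)
Definition block_ok M pi := [forall i,
  if mx_type M then rowsum M i == 1 + mx_length M * (pi i == l)
  else M l i == (i == l) + losses (mx_length M) pi i].

Fixpoint state (At : nat -> 'M[nat]_n.+1) pi s : 'S_n.+1 :=
  if s is s'.+1 then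
    iter (mx_length (At s')) (rauzy (mx_type (At s'))) (state At pi s')
  else pi.

Definition follows N (At : nat -> 'M[nat]_n.+1) pi : bool :=
  [forall s : 'I_N, block_ok (At s) (state At pi s)].

Lemma winner_eq_last t pi : pi l != l -> (l == winner t pi) = ~~ t.
Proof. by move/(loser_neq_winner t); case: t => /=; rewrite ?eqxx // => /negPf. Qed.

Lemma mx_type_run t pi q : pi l != l -> 0 < q -> mx_type (run_mx t pi q) = t.
Proof.
move=> pil q0; rewrite /mx_type rowsum_run // winner_eq_last //.
by case: t; rewrite /= ?muln0 ?muln1 //; case: q q0.
Qed.

Lemma mx_length_run t pi q : pi l != l -> mx_length (run_mx t pi q) = q.
Proof.
move=> pil; rewrite /mx_length.
under eq_bigr do rewrite rowsum_run // addKn.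
rewrite -big_distrr /= (bigD1 (winner t pi)) //= eqxx big1 ?addn0 ?muln1 //.
by move=> i /negPf->.
Qed.

Lemma block_ok_run t pi q : pi l != l -> 0 < q -> block_ok (run_mx t pi q) pi.
Proof.
move=> pil q0; apply/forallP => i; rewrite mx_type_run // mx_length_run //.
case: t; last by rewrite run0_mx_last.
by rewrite rowsum_run //= -{2}(permKV pi l) (inj_eq perm_inj).
Qed.

(** In type 0 the assertion that [pi2] does not fix [l] also comes from the
    matrix: otherwise [l] would lose against itself and its diagonal entry
    would exceed 1. *)
Lemma block_ok_inj t pi1 pi2 q : pi1 l != l -> 0 < q -> block_ok (run_mx t pi1 q) pi2 ->
  if t then (pi1^-1)%g l = (pi2^-1)%g l
  else pi2 l != l /\ forall i, losses q pi1 i = losses q pi2 i.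
Proof.
move=> pil q0 /forallP; rewrite mx_type_run // mx_length_run // => H.
case: t H => H.
  have := H ((pi2^-1)%g l); rewrite rowsum_run // permKV eqxx eqn_add2l eqn_pmul2l //=.
  by case: ((pi2^-1)%g l =P _).
have eql i : losses q pi1 i = losses q pi2 i.
  by have := H i; rewrite run0_mx_last // eqn_add2l => /eqP.
split=> //; apply: contraTneq q0 => pi2l; have := eql l.
rewrite -leqNgt leqn0; case: q {H eql} => // q.
have -> : losses q.+1 pi1 l = 0.
  by rewrite /losses big1 // => r _; rewrite iter_rauzy0_fix // (negPf pil).
by rewrite /losses big_ord_recl /= pi2l eqxx.
Qed.

(** The combinatorial content of [underlying]: the lengths are forgotten, except
    that winner and loser of each step are distinct. *)
Definition rauzy_path m ty (P : nat -> 'S_n.+1) (A At : nat -> 'M[nat]_n.+1) N : Prop :=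
  m 0 = 0 /\ forall s, s < N ->
  [/\ m s < m s.+1,
      forall r, m s <= r < m s.+1 ->
        [/\ ty r = ty (m s), P r l != l, P r.+1 = rauzy (ty r) (P r)
          & A r = step_mx (ty r) (P r)]
    & At s = (\prod_(m s <= r < m s.+1) A r)%R].

Section Path.
Variables (m : nat -> nat) (ty : nat -> bool) (P : nat -> 'S_n.+1).
Variables (A At : nat -> 'M[nat]_n.+1) (N : nat).
Hypothesis path : rauzy_path m ty P A At N.

Let len s := m s.+1 - m s.

Lemma len_gt0 s : s < N -> 0 < len s.
Proof. by case: path => _ H /H[]; rewrite subn_gt0. Qed.

Lemma path_state s q : s < N -> q <= len s -> P (m s + q) = iter q (rauzy (ty (m s))) (P (m s)).
Proof.
case: path => _ H /H[ms Hr _]; elim: q => [|q IH] qs; first by rewrite addn0.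
rewrite addnS iterS -IH ?(ltnW qs) //; have [|<- _ -> //] := Hr (m s + q).
by move: qs; rewrite /len; lia.
Qed.

Lemma path_end s : s < N -> P (m s.+1) = iter (len s) (rauzy (ty (m s))) (P (m s)).
Proof.
by move=> sN; rewrite -path_state // /len subnKC // ltnW //; case: path => _ /(_ s sN)[].
Qed.

Lemma path_movable s : s < N -> P (m s) l != l.
Proof. by case: path => _ H /H[ms Hr _]; have [] := Hr (m s); rewrite ?leqnn. Qed.

Lemma path_block s : s < N -> At s = run_mx (ty (m s)) (P (m s)) (len s).
Proof.
move=> sN; have [_ /(_ s sN)[ms Hr ->]] := path.
rewrite -{1}[m s]add0n big_addn big_mkord /run_mx; apply: eq_bigr => r _.
have rs := ltn_ord r; rewrite -(path_state sN (ltnW rs)) addnC.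
by have [|-> _ _ ->] := Hr (m s + r); first by move: rs; rewrite /len; lia.
Qed.

Lemma path_stateE s : s <= N -> state At (P 0) s = P (m s).
Proof.
elim: s => [|s IH] sN; first by case: path => ->.
by rewrite /= IH ?(ltnW sN) // path_block // mx_length_run ?mx_type_run ?path_end
  ?path_movable ?len_gt0.
Qed.

Lemma path_follows : follows N At (P 0).
Proof.
apply/forallP => s; rewrite path_stateE ?(ltnW (ltn_ord s)) // path_block //.
by apply: block_ok_run; rewrite ?path_movable ?len_gt0.
Qed.

Lemma block_of r : r < m N -> exists2 s, s < N & m s <= r < m s.+1.
Proof.
have [m0 H] := path; elim: {-2}N (leqnn N) => [|M IH] MN; first by rewrite m0.
have [rM _|Mr rM] := ltnP r (m M); first by have [s sM rs] := IH (ltnW MN) rM; exists s; first exact: leqW.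
by exists M; rewrite ?Mr.
Qed.

Section Growing.
Variables (pi2 : 'S_n.+1) (X : nat -> {set 'I_n.+1}).
Hypothesis fol : follows N At pi2.
Hypothesis cX : clustered (P 0) pi2 (X 0).
Hypothesis X1 : 1 < #|X 0|.
Hypothesis X_grow : forall r, X r.+1 = grow (ty r) (P r) (X r).

Lemma path_grown s q : s < N -> q <= len s ->
  X (m s + q) = grown (ty (m s)) (P (m s)) (X (m s)) q.
Proof.
move=> sN; elim: q => [|q IH] qs; first by rewrite addn0.
rewrite addnS X_grow /= -IH ?(ltnW qs) // -path_state ?(ltnW qs) //.
have [_ /(_ s sN)[_ Hr _]] := path; have [|-> //] := Hr (m s + q).
by move: qs; rewrite /len; lia.
Qed.

Lemma leq_card_grown r : 1 < #|X r|.
Proof.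
elim: r => // r IH; rewrite X_grow (leq_trans IH) //.
rewrite -(card_imset (X r) (@perm_inj _ (relabel (ty r) (P r)))).
exact/subset_leq_card/subset_grow.
Qed.

(** The two paths are compared at the ends of the blocks only, since the losers
    of a type 0 block need not come in the same order on both; inside a block,
    [X] follows the steps of the first path. *)
Lemma path_cluster s : s <= N ->
  clustered (P (m s)) (state At pi2 s) (X (m s)) /\
  forall r, r < m s -> winner (ty r) (P r) \in X r -> loser (ty r) (P r) \notin X r.
Proof.
elim: s => [_|s IH sN]; first by case: path => ->.
have [cs ls] := IH (ltnW sN); have pil := path_movable sN.
have [_ /(_ s sN)[ms Hr _]] := path.
have lq : forall q, q < len s -> ty (m s + q) = ty (m s).
  by move=> q; rewrite /len => qs; have [|-> //] := Hr (m s + q); lia.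
have ok : block_ok (run_mx (ty (m s)) (P (m s)) (len s)) (state At pi2 s).
  by rewrite -path_block //; apply: (forallP fol (Ordinal sN)).
have inj := block_ok_inj pil (len_gt0 sN) ok.
have Xs := leq_card_grown (m s).
have {IH}[grow_ok cl] : (forall q, q < len s -> 
   winner (ty (m s)) (iter q (rauzy (ty (m s))) (P (m s))) \in grown (ty (m s)) (P (m s)) (X (m s)) q ->
   loser (ty (m s)) (iter q (rauzy (ty (m s))) (P (m s))) \notin grown (ty (m s)) (P (m s)) (X (m s)) q)
  /\ clustered (P (m s.+1)) (state At pi2 s.+1) (X (m s.+1)).
  rewrite /= path_block // mx_length_run // mx_type_run ?len_gt0 // path_end //.
  have -> : m s.+1 = m s + len s by rewrite subnKC // ltnW.
  rewrite path_grown //; case: (ty _) inj => [e|[pil2 eql]].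
    by have [nw cl _] := grown1 (len s) e cs Xs; split=> // q _; rewrite (negPf (nw q)).
  exact: grown0.
split=> // r rs; have [/ls//|mr] := ltnP r (m s).
have rE : r = m s + (r - m s) by rewrite subnKC.
have q_len : r - m s < len s by rewrite /len; lia.
by rewrite rE lq // path_state ?path_grown ?(ltnW q_len) //; apply: grow_ok.
Qed.

End Growing.

(** The two ends of an edge grow to a set with more elements than there are
    letters. *)
Lemma follows_unique (u : seq (seq 'M[nat]_n.+1)) pi2 :
  flatten u = [seq A r | r <- iota 0 (m N)] -> (forall v, v \in u -> complete v) ->
  n.+1 < 2 ^ (size u).+1 -> follows N At pi2 -> pi2 = P 0.
Proof.
move=> uA cu nu fol; apply/permP => i; apply: agree_value => j; apply/negP => d.
have {}d : differ (P 0) pi2 j i by rewrite /differ eq_sym.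
pose X := fix X r : {set 'I_n.+1} :=
  if r is r'.+1 then grow (ty r') (P r') (X r') else [set j; i].
have X0 : #|X 0| = 2.
  by rewrite cards2; case: eqP d => // ->; rewrite /differ !ltnn.
have cX : clustered (P 0) pi2 (X 0) by apply: clustered_differ.
have X1 : 1 < #|X 0| by rewrite X0.
have [_ lose] := path_cluster fol cX X1 (fun r => erefl) (leqnn N).
have sz : size (flatten u) = m N by rewrite uA size_map size_iota.
have step r : r < m N -> P r l != l /\ A r = step_mx (ty r) (P r).
  by case/block_of => s sN rs; have [_ /(_ s sN)[_ /(_ r rs)[_ ? _ ?] _]] := path.
have := @complete_growth n (m N) ty P A X (fun r h => (step r h).1) (fun r h => (step r h).2)
  (fun r _ => erefl) lose u 0 cu.
rewrite sz add0n leqnn => /(_ isT uA); rewrite X0 -expnSr => big.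
by have := leq_trans nu (leq_trans big (max_card _)); rewrite card_ord ltnn.
Qed.

End Path.

End Following.

(** * From interval exchanges to permutations *)
Section Dynamics.
Variables (R : realType) (n : nat).
Implicit Types (T : 'S_n.+1 * 'cV[R]_n.+1) (At : nat -> 'M[nat]_n.+1).
Local Notation l := (@ord_max n).

Lemma rauzy_stepP t A T T' : rauzy_step t A T T' ->
  [/\ T.1 l != l, T'.1 = rauzy t T.1 & A = step_mx t T.1].
Proof.
case=> l' [k [[l'n kn] lt E -> _]].
have l'E : l' = l by apply/val_inj; case: l'n.
have kE : T.1 k = l by apply/val_inj; case: kn.
subst l'; split; last by rewrite /step_mx -kE permK.
  apply: contraTneq lt => e; have -> : k = l by apply: (@perm_inj _ T.1); rewrite e.
  by case: (t); rewrite ltxx.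
by apply/permP => i; apply/val_inj; rewrite /= rauzyE E -kE permK.
Qed.

Lemma underlying_path N T At A m : underlying (Some N) T At A m ->
  exists ty P, P 0%N = T.1 /\ rauzy_path m ty P A At N.
Proof.
case=> X [t [X0 m0 H]]; exists t, (fun r => (X r).1); split; first by rewrite X0.
split=> // s sN; have [ms Hr ->] := H s sN; split=> // r rs.
by have [-> /rauzy_stepP[? ? ?]] := Hr r rs.
Qed.

Lemma can_define_follows N At pi : can_define R N At pi -> follows N At pi.
Proof.
case=> lam [_ [A [m /underlying_path[ty [P [/= <-]]]]]].
exact: path_follows.
Qed.

Lemma C_complete_unique C N At : (n.+1 < 2 ^ C.+1)%N -> C_complete R C N At ->
  exists2 pi, can_define R N At pi & forall pi', follows N At pi' -> pi' = pi.
Proof.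
move=> nC [[pi lam] [A [m [iet und [u [uC uA cu]]]]]]; exists pi.
  by exists lam; split=> //; exists A, m.
move=> pi' fol; have [ty [P [/= <- path]]] := underlying_path und.
by apply: (follows_unique path uA cu) fol; rewrite uC.
Qed.

(** The rows of an empty product are unit rows, hence a complete path has at
    least one step.  A nonempty input shows the number of intervals. *)
Lemma C_complete_gt0 C N At : (0 < C)%N -> C_complete R C N At -> (0 < N)%N.
Proof.
move=> C0 [T [A [m [_ [X [t [_ m0 _]]] [u [uC uA cu]]]]]].
rewrite lt0n; apply/eqP => N0; move: uA; rewrite N0 m0 /=.
case: u uC cu => [|v u] /= uC cu; first by rewrite -uC in C0.
move=> e; have v0 : v = [::] by case: v e {uC cu}.
have := cu v; rewrite inE eqxx v0 => /(_ isT ord0); rewrite big_nil ltnNge => /negP; apply.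
rewrite -(cards1 (@ord0 n)); apply/subset_leq_card/subsetP => j; rewrite !inE mxE.
by have [] := eqVneq (@ord0 n) j.
Qed.

End Dynamics.

Lemma log2_bound (R : realType) n C : ln (n.+1)%:R / ln 2 - 1 <= C%:R :> R -> (n < 2 ^ C.+1)%N.
Proof.
have l2 : 0 < ln 2 :> R by rewrite ln_gt0 // ltr1n.
rewrite lerBlDr natr1 ler_pdivrMr // => h.
rewrite -(@ler_nat R) natrX -ler_ln ?posrE ?exprn_gt0 ?ltr0n //.
by rewrite lnXn // -[leRHS]mulr_natl.
Qed.

(** * Recursive functions of several variables *)
Section Computability.
Local Open Scope nat_scope.

(** Recursiveness for functions of a list of arguments, of which only the first
    [k] matter.  Binding a variable conses it onto the list, so that the
    variables of an expression are de Bruijn indices. *)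
Definition rec_env k (f : seq nat -> nat) := recursive (fun v : k.-tuple nat => f v).

Lemma re_ext k (f g : seq nat -> nat) :
  rec_env k f -> (forall s, size s = k -> f s = g s) -> rec_env k g.
Proof.
move=> rf fg; rewrite /rec_env.
suff <- : (fun v : k.-tuple nat => f v) = (fun v => g v) by [].
by apply/funext => v; apply: fg; rewrite size_tuple.
Qed.

(** The [d] innermost bound variables are skipped by [d] calls of [behead]. *)
Lemma re_var k d i : d + i < k -> rec_env k (fun s => nth 0 (iter d behead s) i).
Proof.
move=> ik; rewrite /rec_env.
suff -> : (fun v : k.-tuple nat => nth 0 (iter d behead v) i) = (fun v => tnth v (Ordinal ik)).
  exact: rec_proj.
apply/funext => v; rewrite (tnth_nth 0) /=; elim: d i {ik} => //= d IH i.
by rewrite nth_behead IH addnS.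
Qed.

Lemma re_comp m k (g : seq nat -> nat) (hs : seq (seq nat -> nat)) : size hs = m ->
  rec_env m g -> (forall i, i < m -> rec_env k (nth (fun=> 0) hs i)) ->
  rec_env k (fun s => g [seq h s | h : (seq nat -> nat) <- hs]).
Proof.
move=> sz rg rh.
have := @rec_comp k m (fun v => g v) (fun i v => nth (fun=> 0) hs i v) rg (fun i => rh i (ltn_ord i)).
rewrite /rec_env; congr recursive; apply/funext => v; congr g.
apply: (@eq_from_nth _ 0); first by rewrite size_tuple size_map.
move=> i; rewrite size_tuple => im.
by rewrite (nth_map (fun=> 0)) ?sz // -(tnth_nth 0 _ (Ordinal im)) tnth_mktuple.
Qed.

(** Together with [re_app2], [re_app3] and [re_app4]: a function that has been
    proved recursive once can be applied to arbitrary recursive arguments. *)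
Lemma re_app1 F : rec_env 1 (fun s => F (nth 0 s 0)) ->
  forall k a, rec_env k a -> rec_env k (fun s => F (a s)).
Proof.
move=> rF k a ra; apply: (re_comp (hs := [:: a]) _ rF) => //.
by case.
Qed.

Lemma re_app2 F : rec_env 2 (fun s => F (nth 0 s 0) (nth 0 s 1)) ->
  forall k a b, rec_env k a -> rec_env k b -> rec_env k (fun s => F (a s) (b s)).
Proof.
move=> rF k a b ra rb; apply: (re_comp (hs := [:: a; b]) _ rF) => //.
by do 2?case.
Qed.

Lemma re_app3 F : rec_env 3 (fun s => F (nth 0 s 0) (nth 0 s 1) (nth 0 s 2)) ->
  forall k a b c, rec_env k a -> rec_env k b -> rec_env k c ->
  rec_env k (fun s => F (a s) (b s) (c s)).
Proof.
move=> rF k a b c ra rb rc; apply: (re_comp (hs := [:: a; b; c]) _ rF) => //.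
by do 3?case.
Qed.

Lemma re_app4 F :
  rec_env 4 (fun s => F (nth 0 s 0) (nth 0 s 1) (nth 0 s 2) (nth 0 s 3)) ->
  forall k a b c d, rec_env k a -> rec_env k b -> rec_env k c -> rec_env k d ->
  rec_env k (fun s => F (a s) (b s) (c s) (d s)).
Proof.
move=> rF k a b c d ra rb rc rd; apply: (re_comp (hs := [:: a; b; c; d]) _ rF) => //.
by do 4?case.
Qed.

Lemma re_succ k a : rec_env k a -> rec_env k (fun s => (a s).+1).
Proof.
apply: re_app1; have := rec_succ; rewrite /rec_env; congr recursive; apply/funext => v.
by rewrite /thead (tnth_nth 0).
Qed.

Lemma re_const k c : rec_env k (fun=> c).
Proof. by elim: c => [|c IH]; [apply: rec_zero|apply: re_succ]. Qed.

(** The step function receives the counter, the previous value and the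
    parameters, in this order, as in the scheme of primitive recursion. *)
Lemma re_rect k b F e : rec_env k b ->
  rec_env k.+2 (fun s => F (nth 0 s 0) (nth 0 s 1) (behead (behead s))) -> rec_env k e ->
  rec_env k (fun s => nat_rect (fun=> nat) (b s) (fun i r => F i r s) (e s)).
Proof.
move=> rb rF re.
have rec1 : rec_env k.+1 (fun s => nat_rect (fun=> nat) (b (behead s))
    (fun i r => F i r (behead s)) (nth 0 s 0)).
  have := rec_prec rb rF; rewrite /rec_env; congr recursive; apply/funext => v.
  by rewrite /thead (tnth_nth 0) /=.
pose hs := e :: [seq (fun s => nth 0 s i) | i <- iota 0 k].
have rhs : rec_env k (fun s => (fun u => nat_rect (fun=> nat) (b (behead u))
    (fun i r => F i r (behead u)) (nth 0 u 0)) [seq h s | h : (seq nat -> nat) <- hs]).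
  apply: re_comp rec1 _; first by rewrite /= size_map size_iota.
  case=> [//|i] ik; rewrite /= (nth_map 0) ?size_iota // nth_iota // add0n.
  exact: (@re_var k 0).
apply: re_ext rhs _ => s sz; rewrite /= -map_comp.
suff -> : [seq nth 0 s i | i <- iota 0 k] = s by [].
by rewrite -sz; apply: mkseq_nth.
Qed.

Lemma re_iter k F x e : rec_env k e -> rec_env k x ->
  rec_env k.+2 (fun s => F (behead (behead s)) (nth 0 s 1)) ->
  rec_env k (fun s => iter (e s) (F s) (x s)).
Proof.
move=> re rx rF; apply: re_ext (@re_rect _ x (fun _ r s => F s r) e rx rF re) _ => s _.
by elim: (e s).
Qed.

Ltac re_leaf d := lazymatch d with
  | 12 => fail
  | _ => first [ solve [apply: (@re_var _ d); done] | re_leaf constr:(S d) ]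
  end.

(** Every rule is keyed on the head symbol of the expression, so that proof
    search follows its syntax and never unfolds a definition. *)
Create HintDb recdb.
Hint Extern 0 (rec_env _ _) => progress cbv beta : recdb.
Hint Extern 2 (rec_env _ _) => exact: re_const : recdb.
Hint Extern 1 (rec_env _ (fun s => nth _ _ _)) => re_leaf constr:(0) : recdb.
Hint Extern 1 (rec_env _ (fun s => S _)) => apply: re_succ : recdb.
Hint Extern 1 (rec_env _ (fun s => nat_rect _ _ _ _)) => apply: re_rect : recdb.
Hint Extern 1 (rec_env _ (fun s => iter _ _ _)) => apply: re_iter : recdb.
Ltac re_auto := auto 100 with recdb nocore.

Lemma re_add k a b : rec_env k a -> rec_env k b -> rec_env k (fun s => a s + b s).
Proof.
move: k a b; apply: (@re_app2 addn).
apply: (re_ext (f := fun s => nat_rect _ (nth 0 s 1) (fun _ r => r.+1) (nth 0 s 0))) => [|s _].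
  by apply: re_rect; re_auto.
by elim: (nth 0 s 0) => //= x ->.
Qed.
Hint Extern 1 (rec_env _ (fun s => _ + _)) => apply: re_add : recdb.

Lemma re_pred k a : rec_env k a -> rec_env k (fun s => (a s).-1).
Proof.
move: k a; apply: (@re_app1 predn).
apply: (re_ext (f := fun s => nat_rect _ 0 (fun i _ => i) (nth 0 s 0))) => [|s _].
  by apply: re_rect; re_auto.
by case: (nth 0 s 0).
Qed.
Hint Extern 1 (rec_env _ (fun s => _.-1)) => apply: re_pred : recdb.

Lemma re_sub k a b : rec_env k a -> rec_env k b -> rec_env k (fun s => a s - b s).
Proof.
move: k a b; apply: (@re_app2 subn).
apply: (re_ext (f := fun s => nat_rect _ (nth 0 s 0) (fun _ r => r.-1) (nth 0 s 1))) => [|s _].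
  by apply: re_rect; [re_auto|apply: re_pred|]; re_auto.
by elim: (nth 0 s 1) => [|x /= ->]; rewrite ?subn0 ?subnS.
Qed.
Hint Extern 1 (rec_env _ (fun s => _ - _)) => apply: re_sub : recdb.

Lemma re_mul k a b : rec_env k a -> rec_env k b -> rec_env k (fun s => a s * b s).
Proof.
move: k a b; apply: (@re_app2 muln).
apply: (re_ext (f := fun s => nat_rect _ 0 (fun _ r => nth 0 s 1 + r) (nth 0 s 0))) => [|s _].
  by apply: (re_rect (F := fun _ r s => nth 0 s 1 + r)); re_auto.
by elim: (nth 0 s 0) => //= x ->.
Qed.
Hint Extern 1 (rec_env _ (fun s => _ * _)) => apply: re_mul : recdb.

Lemma re_exp2 k a : rec_env k a -> rec_env k (fun s => 2 ^ a s).
Proof.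
move: k a; apply: (@re_app1 (expn 2)).
apply: (re_ext (f := fun s => nat_rect _ 1 (fun _ r => r + r) (nth 0 s 0))) => [|s _].
  by apply: (re_rect (F := fun _ r s => r + r)); re_auto.
by elim: (nth 0 s 0) => //= x ->; rewrite addnn -mul2n expnS.
Qed.
Hint Extern 1 (rec_env _ (fun s => 2 ^ _)) => apply: re_exp2 : recdb.

Section Booleans.
Variables (k : nat).
Implicit Types (b c d : seq nat -> bool) (x y : seq nat -> nat).

Lemma re_not b : rec_env k (fun s => b s) -> rec_env k (fun s => ~~ b s).
Proof.
move=> rb; apply: (re_ext (f := fun s => 1 - b s)) => [|s _]; last by case: (b s).
by apply: re_sub rb; apply: re_const.
Qed.

Lemma re_and b c : rec_env k (fun s => b s) -> rec_env k (fun s => c s) ->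
  rec_env k (fun s => b s && c s).
Proof.
move=> rb rc; apply: (re_ext (f := fun s => b s * c s)) => [|s _]; last by case: (b s); case: (c s).
exact: re_mul.
Qed.

Lemma re_or b c : rec_env k (fun s => b s) -> rec_env k (fun s => c s) ->
  rec_env k (fun s => b s || c s).
Proof.
move=> rb rc; apply: (re_ext (f := fun s => ~~ (~~ b s && ~~ c s))) => [|s _].
  by apply/re_not/re_and; apply: re_not.
by rewrite negb_and !negbK.
Qed.

Lemma re_leq x y : rec_env k x -> rec_env k y -> rec_env k (fun s => x s <= y s).
Proof.
move=> rx ry; apply: (re_ext (f := fun s => 1 - (x s - y s))) => [|s _].
  by apply: re_sub (re_sub rx ry); apply: re_const.
by rewrite -subn_eq0; case: (x s - y s).
Qed.

Lemma re_eq x y : rec_env k x -> rec_env k y -> rec_env k (fun s => x s == y s).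
Proof.
move=> rx ry; apply: (re_ext (f := fun s => (x s <= y s) && (y s <= x s))) => [|s _].
  by apply: re_and; apply: re_leq.
by rewrite eqn_leq.
Qed.

Lemma re_if b x y : rec_env k (fun s => b s) -> rec_env k x -> rec_env k y ->
  rec_env k (fun s => if b s then x s else y s).
Proof.
move=> rb rx ry; apply: (re_ext (f := fun s => b s * x s + (~~ b s) * y s)) => [|s _].
  by apply: re_add; apply: re_mul => //; apply: re_not.
by case: (b s); rewrite /= mul1n mul0n ?addn0.
Qed.

Lemma re_ifb b c d : rec_env k (fun s => b s) -> rec_env k (fun s => c s) ->
  rec_env k (fun s => d s) -> rec_env k (fun s => if b s then c s else d s).
Proof.
move=> rb rc rd; apply: (re_ext (f := fun s => if b s then (c s : nat) else d s)) => [|s _].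
  exact: re_if.
by case: (b s).
Qed.

Lemma re_sum e F : rec_env k e -> rec_env k.+2 (fun s => F (nth 0 s 0) (behead (behead s))) ->
  rec_env k (fun s => \sum_(0 <= i < e s) F i s).
Proof.
move=> re rF; pose G (i r : nat) s := r + F i s.
apply: (re_ext (f := fun s => nat_rect (fun=> nat) 0 (fun i r => G i r s) (e s))) => [|s _].
  by apply: re_rect => //; [apply: re_const|apply: re_add rF; apply: (@re_var _ 0 1)].
by elim: (e s) => [|i /= ->]; [rewrite big_geq|rewrite big_nat_recr].
Qed.

End Booleans.

Hint Extern 1 (rec_env _ (fun s => nat_of_bool (~~ _))) => apply: re_not : recdb.
Hint Extern 1 (rec_env _ (fun s => nat_of_bool (_ && _))) => apply: re_and : recdb.
Hint Extern 1 (rec_env _ (fun s => nat_of_bool (_ || _))) => apply: re_or : recdb.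
Hint Extern 1 (rec_env _ (fun s => nat_of_bool (_ <= _))) => apply: re_leq : recdb.
Hint Extern 1 (rec_env _ (fun s => nat_of_bool (_ == _))) => apply: re_eq : recdb.
Hint Extern 1 (rec_env _ (fun s => nat_of_bool (if _ then _ else _))) => apply: re_ifb : recdb.
Hint Extern 1 (rec_env _ (fun s => if _ then _ else _)) => apply: re_if : recdb.
Hint Extern 1 (rec_env _ (fun s => \sum_(0 <= i < _) _)) => apply: re_sum : recdb.

Definition allb n (P : nat -> bool) := all P (iota 0 n).

Lemma re_allb k e (P : nat -> seq nat -> bool) : rec_env k e ->
  rec_env k.+2 (fun s => P (nth 0 s 0) (behead (behead s))) ->
  rec_env k (fun s => allb (e s) (fun i => P i s)).
Proof.
move=> re rP.
apply: (re_ext (f := fun s => \sum_(0 <= i < e s) ~~ P i s == 0)) => [|s _].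
  apply: re_eq (re_const _ _); apply: (re_sum (F := fun i s => nat_of_bool (~~ P i s))) => //.
  exact: re_not.
rewrite /allb sum_nat_seq_eq0 /index_iota subn0; congr nat_of_bool.
by apply: eq_all => i; case: (P i s).
Qed.
Hint Extern 1 (rec_env _ (fun s => nat_of_bool (allb _ _))) => apply: re_allb : recdb.

(** * The search on codes *)
(** The operations with names ending in [c] are the list operations and the
    notions of the previous parts, acting on codes of lists.  This one is the
    pairing on which [CodeSeq.code] is built: it is a bijection onto the
    positive numbers, which makes 0 the code of the empty list. *)
Definition consc a z := 2 ^ a * (z + z).+1.
(** The double sum has at most one nonzero term, at the unique pair coded by
    [y]; both components of the pair are below [y]. *)
Definition hdc y := \sum_(0 <= a < y) \sum_(0 <= z < y) (consc a z == y) * a.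
Definition tlc y := \sum_(0 <= a < y) \sum_(0 <= z < y) (consc a z == y) * z.
Definition dropc i y := iter i tlc y.
Definition nthc y i := hdc (dropc i y).
Definition sizec y := \sum_(0 <= i < y) ~~ (dropc i y == 0).
Definition mkc n (f : nat -> nat) := nat_rect (fun=> nat) 0 (fun i r => consc (f (n - i.+1)) r) n.

Lemma re_consc k a b : rec_env k a -> rec_env k b -> rec_env k (fun s => consc (a s) (b s)).
Proof. by move: k a b; apply: (@re_app2 consc); rewrite /consc; re_auto. Qed.
Hint Extern 1 (rec_env _ (fun s => consc _ _)) => apply: re_consc : recdb.

Lemma re_hdc k a : rec_env k a -> rec_env k (fun s => hdc (a s)).
Proof. by move: k a; apply: (@re_app1 hdc); rewrite /hdc; re_auto. Qed.
Hint Extern 1 (rec_env _ (fun s => hdc _)) => apply: re_hdc : recdb.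

Lemma re_tlc k a : rec_env k a -> rec_env k (fun s => tlc (a s)).
Proof. by move: k a; apply: (@re_app1 tlc); rewrite /tlc; re_auto. Qed.
Hint Extern 1 (rec_env _ (fun s => tlc _)) => apply: re_tlc : recdb.

Lemma re_dropc k a b : rec_env k a -> rec_env k b -> rec_env k (fun s => dropc (a s) (b s)).
Proof.
move: k a b; apply: (@re_app2 dropc); rewrite /dropc.
by apply: (@re_iter _ (fun=> tlc)); re_auto.
Qed.
Hint Extern 1 (rec_env _ (fun s => dropc _ _)) => apply: re_dropc : recdb.

Lemma re_nthc k a b : rec_env k a -> rec_env k b -> rec_env k (fun s => nthc (a s) (b s)).
Proof. by move: k a b; apply: (@re_app2 nthc); rewrite /nthc; re_auto. Qed.
Hint Extern 1 (rec_env _ (fun s => nthc _ _)) => apply: re_nthc : recdb.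

Lemma re_sizec k a : rec_env k a -> rec_env k (fun s => sizec (a s)).
Proof. by move: k a; apply: (@re_app1 sizec); rewrite /sizec; re_auto. Qed.
Hint Extern 1 (rec_env _ (fun s => sizec _)) => apply: re_sizec : recdb.

(** The entry is evaluated at an expression in the loop counter, because the
    code of a list is built from its end. *)
Lemma re_mkc k e F : rec_env k e ->
  rec_env k.+2 (fun s => F (e (behead (behead s)) - (nth 0 s 0).+1) (behead (behead s))) ->
  rec_env k (fun s => mkc (e s) (fun i => F i s)).
Proof.
move=> re rF; rewrite /mkc.
by apply: (re_rect (F := fun i r s => consc (F (e s - i.+1) s) r)); re_auto.
Qed.
Hint Extern 1 (rec_env _ (fun s => mkc _ _)) => apply: re_mkc : recdb.

(** The position of the largest value, again as a sum with one nonzero term. *)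
Definition lastc n y := \sum_(0 <= i < n) (nthc y i == n.-1) * i.

Lemma re_lastc k a b : rec_env k a -> rec_env k b -> rec_env k (fun s => lastc (a s) (b s)).
Proof. by move: k a b; apply: (@re_app2 lastc); rewrite /lastc; re_auto. Qed.
Hint Extern 1 (rec_env _ (fun s => lastc _ _)) => apply: re_lastc : recdb.

Definition stepc n b y := mkc n (fun i =>
  if b == 1 then
    if i <= lastc n y then nthc y i
    else if i == (lastc n y).+1 then nthc y n.-1 else nthc y i.-1
  else if nthc y i <= nthc y n.-1 then nthc y i
  else if (nthc y i).+1 < n then (nthc y i).+1 else (nthc y n.-1).+1).

Lemma re_stepc k a b c : rec_env k a -> rec_env k b -> rec_env k c ->
  rec_env k (fun s => stepc (a s) (b s) (c s)).
Proof. by move: k a b c; apply: (@re_app3 stepc); rewrite /stepc; re_auto. Qed.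
Hint Extern 1 (rec_env _ (fun s => stepc _ _ _)) => apply: re_stepc : recdb.

Definition runc n b y q := iter q (stepc n b) y.
Lemma re_runc k a b c d : rec_env k a -> rec_env k b -> rec_env k c -> rec_env k d ->
  rec_env k (fun s => runc (a s) (b s) (c s) (d s)).
Proof.
move: k a b c d; apply: (@re_app4 runc); rewrite /runc.
by apply: (@re_iter _ (fun s => stepc (nth 0 s 0) (nth 0 s 1))); re_auto.
Qed.
Hint Extern 1 (rec_env _ (fun s => runc _ _ _ _)) => apply: re_runc : recdb.

Definition dimc x := sizec (nthc x 0).
Lemma re_dimc k a : rec_env k a -> rec_env k (fun s => dimc (a s)).
Proof. by move: k a; apply: (@re_app1 dimc); rewrite /dimc; re_auto. Qed.
Hint Extern 1 (rec_env _ (fun s => dimc _)) => apply: re_dimc : recdb.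

Definition entc x t i j := nthc (nthc (nthc x t) i) j.
Lemma re_entc k a b c d : rec_env k a -> rec_env k b -> rec_env k c -> rec_env k d ->
  rec_env k (fun s => entc (a s) (b s) (c s) (d s)).
Proof. by move: k a b c d; apply: (@re_app4 entc); rewrite /entc; re_auto. Qed.
Hint Extern 1 (rec_env _ (fun s => entc _ _ _ _)) => apply: re_entc : recdb.

Definition rowsumc x t i := \sum_(0 <= j < dimc x) entc x t i j.
Lemma re_rowsumc k a b c : rec_env k a -> rec_env k b -> rec_env k c ->
  rec_env k (fun s => rowsumc (a s) (b s) (c s)).
Proof. by move: k a b c; apply: (@re_app3 rowsumc); rewrite /rowsumc; re_auto. Qed.
Hint Extern 1 (rec_env _ (fun s => rowsumc _ _ _)) => apply: re_rowsumc : recdb.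

Definition typec x t := rowsumc x t (dimc x).-1 == 1.
Definition lenc x t := \sum_(0 <= i < dimc x) (rowsumc x t i - 1).
Lemma re_lenc k a b : rec_env k a -> rec_env k b -> rec_env k (fun s => lenc (a s) (b s)).
Proof. by move: k a b; apply: (@re_app2 lenc); rewrite /lenc; re_auto. Qed.
Hint Extern 1 (rec_env _ (fun s => lenc _ _)) => apply: re_lenc : recdb.
Lemma re_typec k a b : rec_env k a -> rec_env k b -> rec_env k (fun s => typec (a s) (b s)).
Proof.
by move: k a b; apply: (@re_app2 (fun x t => nat_of_bool (typec x t))); rewrite /typec; re_auto.
Qed.
Hint Extern 1 (rec_env _ (fun s => nat_of_bool (typec _ _))) => apply: re_typec : recdb.

Definition statec x y t :=
  nat_rect (fun=> nat) y (fun s z => runc (dimc x) (typec x s) z (lenc x s)) t.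
Lemma re_statec k a b c : rec_env k a -> rec_env k b -> rec_env k c ->
  rec_env k (fun s => statec (a s) (b s) (c s)).
Proof.
move: k a b c; apply: (@re_app3 statec); rewrite /statec.
by apply: (@re_rect _ _ (fun i z s => runc (dimc (nth 0 s 0)) (typec (nth 0 s 0) i) z (lenc (nth 0 s 0) i)));
  re_auto.
Qed.
Hint Extern 1 (rec_env _ (fun s => statec _ _ _)) => apply: re_statec : recdb.

Definition okc x y t := allb (dimc x) (fun i =>
  if typec x t then rowsumc x t i == 1 + lenc x t * (nthc y i == (dimc x).-1)
  else entc x t (dimc x).-1 i == (i == (dimc x).-1) +
    \sum_(0 <= q < lenc x t) (nthc (runc (dimc x) (typec x t) y q) i == (dimc x).-1)).
Lemma re_okc k a b c : rec_env k a -> rec_env k b -> rec_env k c ->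
  rec_env k (fun s => okc (a s) (b s) (c s)).
Proof.
by move: k a b c; apply: (@re_app3 (fun x y t => nat_of_bool (okc x y t))); rewrite /okc; re_auto.
Qed.
Hint Extern 1 (rec_env _ (fun s => nat_of_bool (okc _ _ _))) => apply: re_okc : recdb.

(** The first conjunct excludes words of the wrong length, which would have the
    same entries below [n] but another code. *)
Definition permc n y :=
  (y == mkc n (nthc y)) &&
  allb n (fun i => (nthc y i < n) && allb n (fun j => ~~ (nthc y i == nthc y j) || (i == j))).
Lemma re_permc k a b : rec_env k a -> rec_env k b -> rec_env k (fun s => permc (a s) (b s)).
Proof.
by move: k a b; apply: (@re_app2 (fun n y => nat_of_bool (permc n y))); rewrite /permc; re_auto.
Qed.
Hint Extern 1 (rec_env _ (fun s => nat_of_bool (permc _ _))) => apply: re_permc : recdb.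

Definition goodc x y := permc (dimc x) y && allb (sizec x) (fun t => okc x (statec x y t) t).
(** The code of the constant list [n, ..., n] of length [n] bounds the code of
    every permutation, because the coding is monotone in each entry. *)
Definition boundc x := mkc (dimc x) (fun=> dimc x).
(** The bound makes the search succeed on every input, as the minimization of a
    total recursive function requires. *)
Definition stopc x y := goodc x y || (boundc x <= y).
Lemma re_stopc k a b : rec_env k a -> rec_env k b -> rec_env k (fun s => stopc (a s) (b s)).
Proof.
by move: k a b; apply: (@re_app2 (fun n y => nat_of_bool (stopc n y)));
  rewrite /stopc /goodc /boundc; re_auto.
Qed.

Lemma stopc_ex x : exists y, stopc x y.
Proof. by exists (boundc x); rewrite /stopc leqnn orbT. Qed.

Definition searchc x := ex_minn (stopc_ex x).

Lemma rec_searchc : recursive (fun v : 1.-tuple nat => searchc (nth 0 v 0)).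
Proof.
apply: (@rec_mu 1 (fun v => nat_of_bool (~~ stopc (nth 0 v 1) (nth 0 v 0)))).
- have : rec_env 2 (fun s => ~~ stopc (nth 0 s 1) (nth 0 s 0)); last by [].
  by apply/re_not/re_stopc; re_auto.
- by move=> v /=; rewrite /searchc; case: ex_minnP => y ->.
move=> v a /=; rewrite /searchc; case: ex_minnP => y _ H ay.
by case: (boolP (stopc _ _)) => // /H; rewrite leqNgt ay.
Qed.

End Computability.

(** * Correctness of the search *)
Section Codes.
Local Open Scope nat_scope.
Local Notation code := CodeSeq.code.
Implicit Types (s : seq nat).

Lemma code_cons a s : code (a :: s) = consc a (code s).
Proof. by rewrite /consc addnn. Qed.

Lemma eq_consc a z b y : (consc a z == consc b y) = (a == b) && (z == y).
Proof.
apply/eqP/andP => [|[/eqP-> /eqP->] //].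
rewrite -[z]CodeSeq.decodeK -[y]CodeSeq.decodeK -!code_cons => /(can_inj CodeSeq.codeK)[-> ->].
by rewrite !eqxx.
Qed.

Lemma consc_gt a z : a < consc a z /\ z < consc a z.
Proof.
have := CodeSeq.ltn_code (a :: CodeSeq.decode z).
rewrite code_cons CodeSeq.decodeK => /andP[-> _]; split=> //.
by rewrite /consc -[z.+1]mul1n leq_mul ?expn_gt0 //; lia.
Qed.

Lemma sum_pick n k F : k < n -> \sum_(0 <= i < n) (i == k) * F i = F k.
Proof.
move=> kn; rewrite big_mkord (bigD1 (Ordinal kn)) //= eqxx mul1n big1 ?addn0 // => i.
by rewrite -(inj_eq val_inj) /= => /negPf->.
Qed.

Lemma sum_consc (F : nat -> nat -> nat) a z :
  \sum_(0 <= b < consc a z) \sum_(0 <= y < consc a z) (consc b y == consc a z) * F b y = F a z.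
Proof.
have [ac zc] := consc_gt a z.
rewrite -[RHS](sum_pick (fun b => F b z) ac); apply: eq_bigr => b _.
rewrite -[RHS](sum_pick (fun y => (b == a) * F b y) zc); apply: eq_bigr => y _.
by rewrite eq_consc mulnA mulnb andbC.
Qed.

Lemma hdc_code s : hdc (code s) = head 0 s.
Proof.
case: s => [|a s]; first by rewrite /hdc big_geq.
by rewrite code_cons /hdc (sum_consc (fun b _ => b)).
Qed.

Lemma tlc_code s : tlc (code s) = code (behead s).
Proof.
case: s => [|a s]; first by rewrite /tlc big_geq.
by rewrite code_cons /tlc (sum_consc (fun _ y => y)).
Qed.

Lemma dropc_code i s : dropc i (code s) = code (drop i s).
Proof. by elim: i => [|i IH]; rewrite ?drop0 //= -[LHS]/(tlc (dropc i _)) IH tlc_code -drop1 drop_drop. Qed.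

Lemma nthc_code s i : nthc (code s) i = nth 0 s i.
Proof. by rewrite /nthc dropc_code hdc_code -nth0 nth_drop addn0. Qed.

Lemma size_code s : size s <= code s.
Proof.
by elim: s => //= a s IH; rewrite -[_.+1]mul1n leq_mul ?expn_gt0 //; lia.
Qed.

Lemma code_eq0 s : (code s == 0) = (s == [::]).
Proof. by case: s => //= a s; rewrite muln_eq0 expn_eq0. Qed.

Lemma sizec_code s : sizec (code s) = size s.
Proof.
have count k m : \sum_(0 <= i < m) (i < k) = minn k m.
  elim: m => [|m IH]; first by rewrite big_geq ?minn0.
  by rewrite big_nat_recr //= IH; case: (ltnP m k); lia.
rewrite -[RHS](minn_idPl (size_code s)) -count; apply: eq_bigr => i _.
by rewrite dropc_code code_eq0 -size_eq0 size_drop subn_eq0 -ltnNge.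
Qed.

Lemma mkc_code n f : mkc n f = code (mkseq f n).
Proof.
rewrite /mkc /mkseq; suff H k : k <= n -> nat_rect (fun=> nat) 0 (fun i r => consc (f (n - i.+1)) r) k
    = code [seq f i | i <- iota (n - k) k] by rewrite H // subnn.
elim: k => //= k IH kn; rewrite IH ?(ltnW kn) // -code_cons.
by rewrite subnSK.
Qed.

Lemma allbP n (P : nat -> bool) : reflect (forall i : 'I_n, P i) (allb n P).
Proof.
apply: (iffP allP) => H i; first by apply: H; rewrite mem_iota ltn_ord.
by rewrite mem_iota => iN; apply: (H (Ordinal iN)).
Qed.

Lemma leq_code_bound b s : all (fun a => a <= b) s -> code s <= mkc (size s) (fun=> b).
Proof.
have -> : mkc (size s) (fun=> b) = code (nseq (size s) b).
  rewrite mkc_code; congr code; apply: (@eq_from_nth _ 0); rewrite size_mkseq ?size_nseq // => i iN.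
  by rewrite nth_mkseq // nth_nseq iN.
elim: s => //= a s IH /andP[ab /IH h].
by rewrite leq_mul ?leq_pexp2l // ltnS leq_double.
Qed.

End Codes.

Section Algorithm.
Local Open Scope nat_scope.
Variables (n N : nat) (At : nat -> 'M[nat]_n.+1).
Hypothesis N_gt0 : 0 < N.
Implicit Types (pi : 'S_n.+1) (i j : 'I_n.+1).

Local Notation l := (@ord_max n).
Local Notation code := CodeSeq.code.
Local Notation x := (pickle [seq mx_rows (At s) | s <- iota 0 N]).

Definition perm_code pi := code (perm_word pi).

Lemma size_perm_word pi : size (perm_word pi) = n.+1.
Proof. by rewrite size_map size_enum_ord. Qed.

Lemma nth_perm_code pi i : nthc (perm_code pi) i = pi i.
Proof.
rewrite nthc_code (nth_map ord0) ?size_enum_ord ?ltn_ord //.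
by congr (pi _ : nat); apply/val_inj; rewrite /= nth_enum_ord.
Qed.

Lemma mkc_perm pi (f : nat -> nat) : (forall i, f i = pi i) -> mkc n.+1 f = perm_code pi.
Proof.
move=> fE; rewrite mkc_code; congr code; apply: (@eq_from_nth _ 0).
  by rewrite size_mkseq size_perm_word.
move=> i; rewrite size_mkseq => iN; rewrite nth_mkseq // (fE (Ordinal iN)).
by rewrite -nth_perm_code nthc_code.
Qed.

Lemma nth_input s : s < N -> nthc x s = pickle (mx_rows (At s)).
Proof.
move=> sN; rewrite nthc_code -map_comp (nth_map 0) ?size_iota // nth_iota //.
Qed.

Lemma sizec_input : sizec x = N.
Proof. by rewrite sizec_code !size_map size_iota. Qed.

Lemma dimc_input : dimc x = n.+1.
Proof. by rewrite /dimc nth_input // sizec_code /mx_rows 2!size_map size_enum_ord. Qed.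

Lemma entc_input s i j : s < N -> entc x s i j = At s i j.
Proof.
move=> sN; rewrite /entc nth_input // nthc_code.
have sz (T : Type) (f : 'I_n.+1 -> T) : size [seq f k | k <- enum 'I_n.+1] = n.+1.
  by rewrite size_map size_enum_ord.
rewrite (nth_map [::]) ?sz // (nth_map ord0) ?size_enum_ord // nthc_code.
by rewrite (nth_map 0) ?sz // (nth_map ord0) ?size_enum_ord // !nth_ord_enum.
Qed.

Lemma rowsumc_input s i : s < N -> rowsumc x s i = rowsum (At s) i.
Proof.
move=> sN; rewrite /rowsumc dimc_input big_mkord /rowsum; apply: eq_bigr => j _.
exact: entc_input.
Qed.

Lemma typec_input s : s < N -> typec x s = mx_type (At s).
Proof. by move=> sN; rewrite /typec dimc_input (rowsumc_input l). Qed.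

Lemma lenc_input s : s < N -> lenc x s = mx_length (At s).
Proof.
move=> sN; rewrite /lenc dimc_input big_mkord; apply: eq_bigr => i _.
by rewrite rowsumc_input.
Qed.

Lemma nth_perm_last pi i : (nthc (perm_code pi) i == n) = (pi i == l).
Proof. by rewrite nth_perm_code -(inj_eq val_inj). Qed.

Lemma lastc_perm pi : lastc n.+1 (perm_code pi) = (pi^-1)%g l.
Proof.
rewrite /lastc big_mkord (bigD1 ((pi^-1)%g l)) //= nth_perm_last permKV eqxx mul1n.
rewrite big1 ?addn0 // => i; rewrite nth_perm_last -{1}(permK pi i) (inj_eq perm_inj) => /negPf->.
by [].
Qed.

Lemma stepc_perm (t : bool) pi : stepc n.+1 t (perm_code pi) = perm_code (rauzy t pi).
Proof.
apply: mkc_perm => i; rewrite rauzyE lastc_perm /rauzy_perm nth_perm_code.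
rewrite -[n.+1.-1]/(nat_of_ord l) nth_perm_code; case: t => //=.
case: leqP => // ki; case: eqP => // _.
have -> : i.-1 = ord_pred i :> nat.
  have := ltn_ord i; move: ki; rewrite /=; case: (nat_of_ord i) => //= m _ mn.
  by rewrite modnDr modn_small // ltnW.
by rewrite nth_perm_code.
Qed.

Lemma runc_perm (t : bool) pi q : runc n.+1 t (perm_code pi) q = perm_code (iter q (rauzy t) pi).
Proof. by elim: q => //= q; rewrite /runc /= => ->; apply: stepc_perm. Qed.

Lemma statec_perm pi s : s <= N -> statec x (perm_code pi) s = perm_code (state At pi s).
Proof.
elim: s => //= s IH sN; rewrite IH ?(ltnW sN) // dimc_input typec_input // lenc_input //.
exact: runc_perm.
Qed.

Lemma okc_perm pi s : s < N -> okc x (perm_code pi) s = block_ok (At s) pi.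
Proof.
move=> sN; rewrite /okc dimc_input typec_input // lenc_input //=.
have E i : (if mx_type (At s) then rowsum (At s) i == 1 + mx_length (At s) * (pi i == l)
      else At s l i == (i == l) + losses (mx_length (At s)) pi i) =
    (if mx_type (At s)
     then rowsumc x s i == 1 + mx_length (At s) * (nthc (perm_code pi) i == n)
     else entc x s n i == (i == n :> nat) + \sum_(0 <= q < mx_length (At s))
       (nthc (runc n.+1 (mx_type (At s)) (perm_code pi) q) i == n)).
  case: (mx_type _); first by rewrite nth_perm_last rowsumc_input.
  rewrite (entc_input l) // big_mkord -(inj_eq val_inj); congr (_ == _ + _).
  by apply: eq_bigr => q _; rewrite (runc_perm false) nth_perm_last.
by apply/allbP/forallP => H i; have := H i; rewrite E.
Qed.

Lemma permcP y : reflect (exists pi, y = perm_code pi) (permc n.+1 y).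
Proof.
apply: (iffP andP) => [[/eqP yE /allbP H]|[pi ->]]; last first.
  split; first by rewrite (@mkc_perm pi) // => i; apply: nth_perm_code.
  apply/allbP => i; rewrite nth_perm_code ltn_ord /=; apply/allbP => j.
  rewrite !nth_perm_code -implybE; apply/implyP => /eqP/val_inj/perm_inj->.
  exact: eqxx.
pose f i : 'I_n.+1 := inord (nthc y i).
have fE i : f i = nthc y i :> nat by rewrite inordK //; have /andP[] := H i.
have f_inj : injective f.
  move=> i j /(congr1 val) /=; rewrite !fE => e; apply/val_inj/eqP.
  by have /andP[_ /allbP/(_ j)] := H i; rewrite e eqxx.
by exists (perm f_inj); rewrite yE; apply: mkc_perm => i; rewrite permE.
Qed.

Lemma goodc_perm pi : goodc x (perm_code pi) = follows N At pi.
Proof.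
rewrite /goodc dimc_input sizec_input; have -> : permc n.+1 (perm_code pi) by apply/permcP; exists pi.
apply/allbP/forallP => H s; have := H s; rewrite statec_perm ?(ltnW (ltn_ord s)) //;
 by rewrite okc_perm.
Qed.

(** Any code found below the bound is that of a permutation that follows the
    matrices, so it can only be [pi]. *)
Lemma searchc_follows pi : follows N At pi ->
  (forall pi', follows N At pi' -> pi' = pi) -> searchc x = perm_code pi.
Proof.
move=> fol uniq; rewrite /searchc; case: ex_minnP => y stop min.
have le : y <= perm_code pi by apply: min; rewrite /stopc goodc_perm fol.
have bound : perm_code pi <= boundc x.
  rewrite /boundc dimc_input -{1}(size_perm_word pi); apply: leq_code_bound.
  by apply/allP => a /mapP[i _ ->]; apply: ltnW.
case/orP: stop => [good|yb]; last by apply/anti_leq; rewrite le (leq_trans bound).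
have := good; rewrite /goodc dimc_input => /andP[/permcP[pi' yE] _].
by move: good; rewrite yE goodc_perm => /uniq->.
Qed.

End Algorithm.

Definition algorithm (ms : seq (seq (seq nat))) : seq nat :=
  CodeSeq.decode (searchc (pickle ms)).

Lemma computable_algorithm : computable algorithm.
Proof.
exists (fun v => searchc (nth 0 v 0)); first exact: rec_searchc.
by move=> ms; rewrite /= -[RHS]/(CodeSeq.code (map id _)) map_id CodeSeq.decodeK.
Qed.

(** * Recovery of the permutation *)
Unset Implicit Arguments.

Theorem theorem1 (R : realType) :
  exists2 algo : seq (seq (seq nat)) -> seq nat, computable algo &
  forall (n : nat) (T : 'S_n * 'cV[R]_n) (L : option nat)
         (At : nat -> 'M[nat]_n) (C N : nat),
    (2 <= n)%N ->
    is_iet T -> idoc T -> zorich_moves L T At ->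
    (0 < C)%N -> ln (n.+1)%:R / ln 2 - 1 <= C%:R :> R ->
    (forall i, (i < N)%N -> in_range L i) ->
    C_complete R C N At ->
    exists pi : 'S_n,
      [/\ can_define R N At pi,
          forall pi' : 'S_n, can_define R N At pi' -> pi' = pi
        & algo [seq mx_rows (At i) | i <- iota 0 N] = perm_word pi].
Proof.
exists algorithm; first exact: computable_algorithm.
move=> [//|n] T L At C N n2 _ _ _ C_gt0 C_large _ comp.
have [pi def uniq] := C_complete_unique (log2_bound C_large) comp.
exists pi; split=> // [pi' /can_define_follows /uniq //|].
have N_gt0 := C_complete_gt0 C_gt0 comp.
by rewrite /algorithm (searchc_follows N_gt0 (can_define_follows def) uniq) CodeSeq.codeK.
Qed.
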